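(* Let $p\ge 3$. For every $n\ge1$ and every discrete martingale-difference sequence $d=\{d_1,\dots,d_n\}$, $$\left\|\sum_{k=1}^n d_k\right\|_p\le 2^{1/2}\left(\frac{\Gamma((p+1)/2)}{\sqrt\pi}\right)^{1/p}\|\mathfrak S(d)\|_\infty,$$ and the constant $2^{1/2}\big(\Gamma((p+1)/2)/\sqrt\pi\big)^{1/p}$ is the best possible (no smaller constant works for all $n$ and all discrete martingale-difference sequences $d=\{d_1,\dots,d_n\}$).
   Context: All random variables are real-valued. Let $(X,\mathscr F,\mu)$ be a probability space. A discrete filtration is an increasing sequence of $\sigma$-algebras $\mathscr F_0\subset\mathscr F_1\subset\dots\subset\mathscr F$ such that each $\mathscr F_k$ is generated by a finite or countable partition $\mathscr D_k$ of $X$ into disjoint measurable sets of positive measure, where $\mathscr D_0=\{X\}$ and every set in $\mathscr D_k$ is a union of elements of $\mathscr D_{k+1}$. A discrete martingale-difference sequence $d=\{d_1,\dots,d_n\}$ with respect to such a filtration is a sequence of integrable random variables with $d_k$ being $\mathscr F_k$-measurable and $\int_V d_k\,d\mu=0$ for every $V\in\mathscr D_{k-1}$, $k=1,\dots,n$. Its square function is $$\mathfrak S(d)(x)=\Big(\sum_{k=1}^n |D_k(x)|^2\Big)^{1/2},\qquad D_k(x)=\sum_{V\in\mathscr D_{k-1}}\|\mathbf 1_V d_k\|_\infty\,\mathbf 1_V(x).$$ The probability space and the filtration are arbitrary. *)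

(* Defs.v *)
From HB Require Import structures.
From mathcomp Require Import all_boot all_order all_algebra.
From mathcomp Require Import all_classical all_reals all_analysis.
Set Implicit Arguments.
Unset Strict Implicit.
Unset Printing Implicit Defensive.
Import Order.TTheory GRing.Theory Num.Theory.
Import numFieldNormedType.Exports.
Local Open Scope classical_set_scope.
Local Open Scope ring_scope.
Local Open Scope ereal_scope.

Definition Gamma (R : realType) (s : R) : R :=
  (\int[lebesgue_measure]_(t in `]0%R, +oo[) (t `^ (s - 1) * expR (- t)))%R.

(* The k-th sigma-algebra is not a separate datum: it is [<<s D k >>].  That
   these increase and lie below the ambient sigma-algebra follows from
   refinement and countability, see the two lemmas after the record. *)
Record discrete_filtration disp (T : measurableType disp) (R : realType)
    (mu : probability T R) (D : nat -> set (set T)) : Prop := {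
  dfilt0 : D 0%N = [set [set: T]] ;
  dfilt_countable : forall k, countable (D k) ;
  dfilt_partition : forall k, partition (D k) id [set: T] ;
  dfilt_measurable : forall k V, D k V -> measurable V ;
  dfilt_gt0 : forall k V, D k V -> 0 < mu V ;
  dfilt_refine : forall k V, D k V ->
    exists2 A : set (set T), A `<=` D k.+1 & V = \bigcup_(W in A) W }.

Lemma dfilt_sigma_mono disp (T : measurableType disp) (R : realType)
    (mu : probability T R) (D : nat -> set (set T)) (k : nat) :
  discrete_filtration mu D -> <<s D k >> `<=` <<s D k.+1 >>.
Proof.
move=> h; apply: smallest_sub; first exact: smallest_sigma_algebra.
move=> V /(dfilt_refine h)[A AD ->]; rewrite bigcup_set_type.
apply: (@countable_bigcupT_measurable _ (g_sigma_algebraType (D k.+1))).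
  rewrite (eq_countable (card_setT A)).
  exact: sub_countable (subset_card_le AD) (dfilt_countable h _).
by move=> W; apply: sub_sigma_algebra; exact/AD/set_valP.
Qed.

Lemma dfilt_sigma_sub disp (T : measurableType disp) (R : realType)
    (mu : probability T R) (D : nat -> set (set T)) (k : nat) :
  discrete_filtration mu D -> <<s D k >> `<=` measurable.
Proof.
move=> h; apply: smallest_sub; first exact: sigma_algebra_measurable.
exact: (dfilt_measurable h).
Qed.

(* The sequence d_1, ..., d_n is stored with a shift: [d i], i < n, is
   d_{i+1}. *)
Record mdiff_sequence disp (T : measurableType disp) (R : realType)
    (mu : probability T R) (D : nat -> set (set T)) (n : nat)
    (d : 'I_n -> T -> R) : Prop := {
  mdiff_integrable : forall i, mu.-integrable [set: T] (EFin \o d i) ;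
  mdiff_adapted : forall i : 'I_n,
    measurable_fun [set: g_sigma_algebraType (D i.+1)] (d i) ;
  mdiff_mean0 : forall (i : 'I_n) V, D i V -> \int[mu]_(x in V) (d i x)%:E = 0 }.

(* On each V in D_i, the constant ||1_V d_{i+1}||_oo, which may be +oo. *)
Definition sup_block disp (T : measurableType disp) (R : realType)
    (mu : probability T R) (D : nat -> set (set T)) (n : nat)
    (d : 'I_n -> T -> R) (i : 'I_n) (x : T) : \bar R :=
  \esum_(V in D i)
    ('N[mu]_+oo[EFin \o (\1_V \* d i)%R] * (\1_V x)%:E).

Definition square_function disp (T : measurableType disp) (R : realType)
    (mu : probability T R) (D : nat -> set (set T)) (n : nat)
    (d : 'I_n -> T -> R) (x : T) : \bar R :=
  (\sum_(i < n) `|sup_block mu D d i x| ^+ 2) `^ (2^-1).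

(* The comparison is made in the extended reals: for c > 0 it is vacuous when
   the norm of the square function is infinite. *)
Definition square_function_bound (R : realType) (p c : R) : Prop :=
  forall (disp : measure_display) (T : measurableType disp)
    (mu : probability T R) (D : nat -> set (set T)) (n : nat)
    (d : 'I_n -> T -> R),
  (1 <= n)%N -> discrete_filtration mu D -> mdiff_sequence mu D d ->
  'N[mu]_p%:E[EFin \o (fun x => \sum_(i < n) d i x)%R] <=
    c%:E * 'N[mu]_+oo[square_function mu D d].

(* Main.v *)
From HB Require Import structures.
Require Import Defs.
From mathcomp Require Import all_boot all_order all_algebra.
From mathcomp Require Import zify ring lra.
From mathcomp Require Import all_classical all_reals all_analysis.
From mathcomp Require Import measurable_realfun ess_sup_inf.
Set Implicit Arguments.
Unset Strict Implicit.
Unset Printing Implicit Defensive.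
Import Order.TTheory GRing.Theory Num.Theory.
Import numFieldNormedType.Exports.
Local Open Scope classical_set_scope.
Local Open Scope ring_scope.

(** The constant is the p-th root of the absolute moment E|g|^p of a standard
    Gaussian g, and it is reached from below by normalized simple random walks.

    Write f(x) = |x|^p and (avg h f)(x) = (f(x+h) + f(x-h))/2.  For p >= 3 the
    function s |-> (avg s f)(y) is convex in s^2, because its derivative in s is
    convex on [0, +oo[ and vanishes at 0.  Hence avg c f <= avg a (avg b f) when
    c^2 = a^2 + b^2, an inequality preserved by all the averaging operators,
    and a symmetric step of size c is dominated by k symmetric steps of size h
    as soon as c^2 <= k h^2.  A martingale difference bounded by D on a block is
    dominated, by convexity, by a symmetric step of size D, hence by about
    D^2/h^2 steps of size h.  Iterating, E f(d_1 + ... + d_n) is at most the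
    p-th moment of a simple random walk with K steps of size h, where K h^2
    exceeds the squared norm of the square function by at most n h^2; then h
    tends to 0.  Conversely the simple random walk is itself a discrete
    martingale, so that only the limit of its normalized moments is needed.

    That limit comes from Wallis' product, exponential bounds on ratios of
    binomial coefficients, and dominated convergence.  The moment of the walk
    with 2m steps is written as the integral of a function constant on the
    intervals [j^2/m, (j+1)^2/m[, which converges pointwise to a multiple of the
    integrand of Gamma((p+1)/2), so that no change of variables occurs. *)

(** * Symmetric averages and the power function *)

Section SymmetricAverages.
Context {R : realType}.
Implicit Types (f : R -> R) (x y a b c h : R).

Definition avg h f x := (f (x + h) + f (x - h)) / 2.

Definition cvx f := forall x y t, 0 <= t <= 1 ->
  f (t * x + (1 - t) * y) <= t * f x + (1 - t) * f y.

(* The midpoint form of: [s |-> avg s f y] is a convex function of [s ^+ 2]. *)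
Definition sqcvx f := forall y a b c, c ^+ 2 = a ^+ 2 + b ^+ 2 ->
  avg c f y <= avg a (avg b f) y.

Lemma avgC a b f : avg a (avg b f) = avg b (avg a f).
Proof.
apply/funext => x; rewrite /avg (addrAC x b a) (addrAC x b (- a)).
by rewrite (addrAC x (- b) a) (addrAC x (- b) (- a)); field.
Qed.

Lemma avgN h f : avg (- h) f = avg h f.
Proof. by apply/funext => x; rewrite /avg opprK [in RHS]addrC. Qed.

Lemma le_avg h f g : (forall x, f x <= g x) -> forall x, avg h f x <= avg h g x.
Proof. by move=> fg x; rewrite /avg ler_pM2r ?invr_gt0// lerD. Qed.

Lemma cvx_avg h f : cvx f -> cvx (avg h f).
Proof.
move=> cf x y t t01; rewrite /avg.
have := cf (x + h) (y + h) _ t01; have := cf (x - h) (y - h) _ t01.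
have -> : t * (x - h) + (1 - t) * (y - h) = t * x + (1 - t) * y - h by ring.
have -> : t * (x + h) + (1 - t) * (y + h) = t * x + (1 - t) * y + h by ring.
lra.
Qed.

Lemma cvx_iter_avg h f k : cvx f -> cvx (iter k (avg h) f).
Proof. by move=> cf; elim: k => //= k; exact: cvx_avg. Qed.

Lemma sqcvx_avg h f : sqcvx f -> sqcvx (avg h f).
Proof.
move=> sf y a b c abc; rewrite (avgC c) (avgC b) (avgC a).
by apply: le_avg => x; exact: sf.
Qed.

Lemma sqcvx_iter_avg h f k : sqcvx f -> sqcvx (iter k (avg h) f).
Proof. by move=> sf; elim: k => //= k; exact: sqcvx_avg. Qed.

Lemma avg0 f : avg 0 f = f.
Proof. by apply/funext => x; rewrite /avg subr0 addr0; field. Qed.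

(** The points [x + a] and [x - a] are convex combinations of [x + b] and [x - b] with exchanged
    weights [t] and [1 - t], so adding the two convexity inequalities makes the weights
    disappear. *)
Lemma cvx_avg_homo f x a b : cvx f -> `|a| <= b -> avg a f x <= avg b f x.
Proof.
move=> cf ab; have [b0|b0] := leP b 0.
  by have -> : b = a by move: ab; rewrite ler_norml; lra.
move: ab; rewrite ler_norml => /andP[ab1 ab2].
pose t := (b + a) / (2 * b).
have t01 : 0 <= t <= 1.
  by rewrite /t divr_ge0 ?ler_pdivrMr ?mulr_gt0//=; lra.
have tb : t * (2 * b) = b + a by rewrite /t divfK// gt_eqF ?mulr_gt0.
have := cf (x + b) (x - b) _ t01; have := cf (x - b) (x + b) _ t01.
have -> : t * (x + b) + (1 - t) * (x - b) = x + a by lra.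
have -> : t * (x - b) + (1 - t) * (x + b) = x - a by lra.
rewrite /avg; lra.
Qed.

Lemma le_avg_self f x a : cvx f -> f x <= avg a f x.
Proof.
move=> cf; have := @cvx_avg_homo f x 0 `|a| cf; rewrite normr0 avg0 => /(_ (normr_ge0 _)).
by have [a0|a0] := ger0P a; rewrite ?avgN.
Qed.

(** Induction on [k] with [c] arbitrary. First [c] is enlarged to [e'], the hypotenuse of [h] and
    [e], where [e ^+ 2 = k%:R * h ^+ 2]; then [sqcvx] splits off one step of size [h] and leaves a
    step of size [e]. *)
Lemma avg_le_iter f h k x c : cvx f -> sqcvx f -> c ^+ 2 <= k%:R * h ^+ 2 ->
  avg c f x <= iter k (avg h) f x.
Proof.
move=> cf sf; elim: k x c => [|k IH] x c.
  rewrite mul0r real_exprn_even_le0 ?num_real//= => /eqP ->.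
  by rewrite avg0.
move=> ch; have k0 : 0 <= k%:R :> R by [].
have h0 := sqr_ge0 h.
have kh : 0 <= k%:R * h ^+ 2 by rewrite mulr_ge0.
pose e := Num.sqrt (k%:R * h ^+ 2).
have e2 : e ^+ 2 = k%:R * h ^+ 2 by rewrite sqr_sqrtr.
pose e' := Num.sqrt (e ^+ 2 + h ^+ 2).
have e'2 : e' ^+ 2 = e ^+ 2 + h ^+ 2 by rewrite sqr_sqrtr// addr_ge0// sqr_ge0.
apply: (@le_trans _ _ (avg e' f x)).
  apply: cvx_avg_homo => //.
  rewrite -sqrtr_sqr ler_wsqrtr// (le_trans ch)// e2 -natr1; lra.
apply: (le_trans (sf x e h e' e'2)).
rewrite avgC /=; apply: le_avg => z; apply: IH; by rewrite e2.
Qed.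

(* One martingale step: an increment of size at most [D] is dominated, up to
   a multiple of itself, by [r] symmetric steps of size [h]. *)
Lemma iter_avg_step f h k r x D : cvx f -> sqcvx f -> 0 <= D ->
  D ^+ 2 <= r%:R * h ^+ 2 ->
  exists C, forall d, `|d| <= D ->
    iter k (avg h) f (x + d) <= iter (k + r) (avg h) f x + C * d.
Proof.
move=> cf sf D0 Dr; set g := iter k (avg h) f.
have cg : cvx g by exact: cvx_iter_avg.
have sg : sqcvx g by exact: sqcvx_iter_avg.
have rg : avg D g x <= iter (k + r) (avg h) f x.
  by rewrite addnC iterD; exact: avg_le_iter.
(* [C] is the slope of the chord of [g] over [[x - D, x + D]]. The chord lies above [g] there, and
   its value at [x] is [avg D g x]. *)
exists ((g (x + D) - g (x - D)) / (2 * D)) => d dD.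
apply: (@le_trans _ _ (avg D g x + (g (x + D) - g (x - D)) / (2 * D) * d)); last first.
  by rewrite lerD2r.
have [D0'|D0'] := leP D 0.
  have -> : D = 0 by lra.
  have -> : d = 0 by move: dD; rewrite ler_norml; lra.
  by rewrite avg0 addr0 mulr0 addr0.
move: dD; rewrite ler_norml => /andP[dD1 dD2].
pose t := (D + d) / (2 * D).
have t01 : 0 <= t <= 1.
  by rewrite /t divr_ge0 ?ler_pdivrMr ?mulr_gt0//=; lra.
have tb : t * (2 * D) = D + d by rewrite /t divfK// gt_eqF ?mulr_gt0.
have := cg (x + D) (x - D) _ t01.
have -> : t * (x + D) + (1 - t) * (x - D) = x + d by lra.
move=> /le_trans; apply.
rewrite le_eqVlt; apply/orP; left; apply/eqP.
have -> : (1 - t) = (D - d) / (2 * D) by rewrite /t; field; rewrite gt_eqF.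
by rewrite /t /avg; field; rewrite gt_eqF.
Qed.

End SymmetricAverages.

(** * The absolute power and its convexity in the square of the step *)

Section PowerFunction.
Context {R : realType}.
Implicit Types (f : R -> R) (x y a b c h p q r s : R).

Lemma cvx_norm_powR q : 1 <= q -> cvx (fun x => `|x| `^ q).
Proof.
move=> q1 x y t /andP[t0 t1]; have q0 : 0 <= q by lra.
apply: (@le_trans _ _ ((t * `|x| + (1 - t) * `|y|) `^ q)).
  apply: ge0_ler_powR => //; rewrite ?nnegrE ?addr_ge0 ?mulr_ge0 ?subr_ge0//.
  rewrite (le_trans (ler_normD _ _))// !normrM (ger0_norm t0).
  by rewrite (@ger0_norm _ (1 - t)) ?subr_ge0.
by apply: (convex_powR q1 (Itv01 t0 t1)) => /=;
  rewrite ?inE/= ?in_itv/= ?normr_ge0.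
Qed.

Lemma is_derive_spowR r x : 0 < r ->
  is_derive x 1 (fun z : R => z * `|z| `^ r) ((r + 1) * `|x| `^ r).
Proof.
move=> r0; set F : R -> R := (fun z => _).
have r1 : 0 < r + 1 by rewrite addr_gt0.
have Fpos (z : R) : 0 < z -> is_derive z 1 F ((r + 1) * `|z| `^ r).
  move=> z0; apply: (@near_eq_is_derive _ _ _ (fun z => z `^ (r + 1))).
    near=> y; have y0 : 0 < y by near: y; exact: lt_nbhsr.
    by rewrite /F gtr0_norm// -[in RHS](addrK 1 r) mulr_powRB1// ltW.
  by apply: (is_derive_eq (is_derive1_powR (r + 1) z0)); rewrite addrK gtr0_norm.
have [x0|x0|->] := ltgtP x 0; last 2 first.
- exact: Fpos.
- rewrite normr0 powR0 ?gt_eqF// mulr0.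
  (* At 0 the difference quotient is [|h|]^ r[, which is below]e[as soon as]|h| < e [^ r^-1]. *)
  have cv : h^-1 *: (F (h *: 1 + 0) - F 0) @[h --> 0^'] --> (0 : R).
    apply/cvgrPdist_lt => e e0.
    near=> h; have h0 : h != 0 by near: h; exact: nbhs_dnbhs_neq.
    rewrite sub0r normrN /F addr0 normr0 mul0r subr0 /GRing.scale/= mulr1.
    rewrite mulrA mulVf// mul1r ger0_norm ?powR_ge0//.
    have he : `|h| < e `^ r^-1.
      near: h; apply: dnbhs0_lt; exact: powR_gt0.
    rewrite -(@powRr1 _ e) ?ltW// -(@mulVf _ r) ?gt_eqF// powRrM.
    by apply: gt0_ltr_powR; rewrite ?nnegrE ?powR_ge0.
  split; first by apply/cvg_ex; exists 0.
  exact: cvg_lim.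
(* [F] is odd, so the negative case follows from the positive one. *)
- have -> : F = - (F \o -%R).
    by apply/funext => z; rewrite /F /= !fctE/= normrN mulNr opprK.
  have Nx : 0 < - x by rewrite oppr_gt0.
  have dF := Fpos _ Nx.
  have dN : is_derive x 1 (-%R : R -> R) (-1) by exact: is_deriveN.
  have := is_deriveN (@is_derive1_comp _ F -%R x _ _ dF dN).
  move/is_derive_eq; apply.
  by rewrite mulrN1 opprK normrN.
Unshelve. all: by end_near. Qed.

(** With [|z|]^ p[written as]z[times]z * |z| [^ (p - 2)], the product rule also covers the
    origin. *)
Lemma is_derive_norm_powR p x : 2 < p ->
  is_derive x 1 (fun z => `|z| `^ p) (p * (x * `|x| `^ (p - 2))).
Proof.
move=> p2; have r0 : 0 < p - 2 by rewrite subr_gt0.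
have -> : (fun z : R => `|z| `^ p) = id * (fun z : R => z * `|z| `^ (p - 2)).
  apply/funext => z; rewrite fctE mulrA.
  have [->|z0] := eqVneq z 0; first by rewrite normr0 powR0 ?mul0r// gt_eqF//; lra.
  rewrite -expr2 -(real_normK (num_real z)) -powR_mulrn// -powRD; last first.
    by rewrite normr_eq0 z0 implybT.
  by congr (_ `^ _); lra.
have h := is_derive_spowR x r0.
apply: (is_derive_eq (is_deriveM (is_derive_id x 1) h)).
rewrite /GRing.scale/= mulr1; ring.
Qed.

Lemma MVT_derivable f (df : R -> R) a b : a < b ->
  (forall x, is_derive x 1 f (df x)) ->
  exists2 c, a < c < b & f b - f a = df c * (b - a).
Proof.
move=> ab fdf.
have [|c] := @MVT R f df a b ab (fun x _ => fdf x).
  apply: continuous_subspaceT => x.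
  by apply/differentiable_continuous/derivable1_diffP; have [] := fdf x.
by rewrite in_itv/= => ? ?; exists c.
Qed.

(** The quotient [K x / x] is non-decreasing on the positive half-line: it is the mean slope of [K]
    from 0, and the mean value theorem on [[0, x]] and [[x, y]] compares it with the slope further
    on. *)
Lemma derive_homo_slope (K dK : R -> R) x y : K 0 = 0 ->
  (forall x, is_derive x 1 K (dK x)) ->
  (forall x y, 0 <= x <= y -> dK x <= dK y) ->
  0 < x <= y -> K x * y <= K y * x.
Proof.
move=> K0 KdK dK_homo /andP[x0]; rewrite le_eqVlt => /predU1P[->//|xy].
have [c1 /andP[c10 c1x]] := MVT_derivable x0 KdK; rewrite K0 !subr0 => E1.
have [c2 /andP[c2x c2y]] := MVT_derivable xy KdK => E2.
have := dK_homo c1 c2; rewrite (ltW c10) (ltW (lt_trans c1x c2x)) => /(_ isT) d.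
have -> : K y = K x + dK c2 * (y - x) by rewrite -E2; ring.
rewrite E1 -subr_ge0.
have -> : (dK c1 * x + dK c2 * (y - x)) * x - dK c1 * x * y =
   (dK c2 - dK c1) * ((y - x) * x) by ring.
by rewrite mulr_ge0// ?subr_ge0// mulr_ge0 ?subr_ge0// ltW.
Qed.

(** As [K z / z] increases, [H] is convex as a function of [z ^+ 2], and this is its tangent
    inequality at [x ^+ 2]. The difference [Phi] between [H] and the tangent has a derivative that
    is nonpositive before [x] and nonnegative after it. *)
Lemma slope_homo_tangent (H K : R -> R) x y :
  (forall x, is_derive x 1 H (K x)) ->
  (forall x y, 0 < x <= y -> K x * y <= K y * x) -> 0 < x -> 0 <= y ->
  H x + K x / (2 * x) * (y ^+ 2 - x ^+ 2) <= H y.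
Proof.
move=> HK slope x0 y0; set c := K x / (2 * x).
have cx : K x = c * (2 * x) by rewrite divfK// gt_eqF ?mulr_gt0.
pose Phi (z : R) := H z - c * z ^+ 2.
have dPhi (z : R) : is_derive z 1 Phi (K z - c * (2 * z)).
  have h := HK z; apply: is_derive_eq.
  by rewrite /GRing.scale/=; ring.
suff : Phi x <= Phi y by rewrite /Phi; lra.
have [xy|yx|<-//] := ltgtP x y.
  have [z /andP[xz zy] E] := MVT_derivable xy dPhi.
  rewrite -subr_ge0 E mulr_ge0 ?subr_ge0 ?(ltW xy)//.
  have := slope x z; rewrite x0 (ltW xz) => /(_ isT); rewrite cx.
  have -> : c * (2 * x) * z = c * (2 * z) * x by ring.
  by rewrite ler_pM2r.
have [z /andP[yz zx] E] := MVT_derivable yx dPhi.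
have z0 : 0 < z by rewrite (le_lt_trans y0).
rewrite -subr_le0 E mulr_le0_ge0 ?subr_ge0 ?(ltW yx)// subr_le0.
have := slope z x; rewrite z0 (ltW zx) => /(_ isT); rewrite cx.
have -> : c * (2 * x) * z = c * (2 * z) * x by ring.
by rewrite ler_pM2r.
Qed.

Lemma sqcvx_norm_powR p : 3 <= p -> sqcvx (fun x => `|x| `^ p).
Proof.
move=> p3 y a b c abc; set f : R -> R := fun x => _.
pose phi (z : R) := z * `|z| `^ (p - 2).
pose g (z : R) := `|z| `^ (p - 2).
have p2 : 2 < p by lra.
have p20 : 0 < p - 2 by lra.
pose H (s : R) := f (y + s) + f (y - s).
pose K (s : R) := p * (phi (y + s) - phi (y - s)).
pose dK (s : R) := p * ((p - 1) * (g (y + s) + g (y - s))).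
have dp (s : R) : is_derive s 1 (fun s : R => y + s) 1.
  by apply: is_derive_eq; ring.
have dm (s : R) : is_derive s 1 (fun s : R => y - s) (-1).
  by apply: is_derive_eq; ring.
have dH (s : R) : is_derive s 1 H (K s).
  have h1 := @is_derive1_comp _ f _ s _ _ (is_derive_norm_powR (y + s) p2) (dp s).
  have h2 := @is_derive1_comp _ f _ s _ _ (is_derive_norm_powR (y - s) p2) (dm s).
  by apply: (is_derive_eq (is_deriveD h1 h2)); rewrite /K /phi; ring.
have dKs (s : R) : is_derive s 1 K (dK s).
  have h1 := @is_derive1_comp _ phi _ s _ _ (is_derive_spowR (y + s) p20) (dp s).
  have h2 := @is_derive1_comp _ phi _ s _ _ (is_derive_spowR (y - s) p20) (dm s).
  apply: (is_derive_eq (is_deriveZ p (is_deriveB h1 h2))).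
  by rewrite /dK /g /GRing.scale/=; ring.
(* This is where [3 <= p] enters: the exponent [p - 2] must be at least 1. *)
have cg : cvx g by apply: cvx_norm_powR; lra.
have slope (s t : R) : 0 < s <= t -> K s * t <= K t * s.
  apply: (@derive_homo_slope K dK) => // [|u v /andP[u0 uv]].
    by rewrite /K addr0 subr0 subrr mulr0.
  rewrite /dK !ler_pM2l ?subr_gt0; [|lra..].
  have := @cvx_avg_homo _ g y u v cg; rewrite ger0_norm// => /(_ uv).
  by rewrite /avg ler_pM2r.
have Habs (s : R) : H `|s| = H s.
  by rewrite /H; have [s0|s0] := ger0P s => //; rewrite opprK addrC.
pose d := `|c|.
(* The tangent slope has [c] in its denominator; for [c = 0] both [a] and [b] vanish. *)
have [c0|c0] := eqVneq c 0.
  have : a ^+ 2 + b ^+ 2 = 0 by rewrite -abc c0 expr0n.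
  move/eqP; rewrite paddr_eq0 ?sqr_ge0// !sqrf_eq0 => /andP[/eqP -> /eqP ->].
  by rewrite c0 !avg0.
have d0 : 0 < d by rewrite normr_gt0.
(* The squares of [a + b] and [a - b] average to [a ^+ 2 + b ^+ 2 = c ^+ 2], so in the mean of the
   two tangent inequalities the linear terms cancel. Evenness of [H] removes the absolute values. *)
have := slope_homo_tangent dH slope d0 (normr_ge0 (a + b)).
have := slope_homo_tangent dH slope d0 (normr_ge0 (a - b)).
rewrite !Habs !real_normK ?num_real//.
set k := _ / _; rewrite abc => h1 h2.
have E2 : avg a (avg b f) y = (H (a + b) + H (a - b)) / 2 / 2.
  rewrite /avg /H opprD opprB !addrA (addrAC y b (- a)); by field.
rewrite -[avg c f y]/(H c / 2) E2.
have -> : H c = (H c + k * ((a - b) ^+ 2 - (a ^+ 2 + b ^+ 2)) +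
  (H c + k * ((a + b) ^+ 2 - (a ^+ 2 + b ^+ 2)))) / 2 by field.
lra.
Qed.

End PowerFunction.

(** * Moments of the simple random walk *)

Section Wallis.
Context {R : realType}.
Implicit Types (x : R) (m n j k : nat).

(* The reduction formula obtained by integrating [cos ^+ n] by parts. *)
Fixpoint primitive_cos n x : R :=
  match n with
  | 0 => x
  | 1 => sin x
  | n'.+2 => (sin x * cos x ^+ n'.+1 + n'.+1%:R * primitive_cos n' x) / n'.+2%:R
  end.

Lemma is_derive_primitive_cos n x :
  is_derive x 1 (primitive_cos n) (cos x ^+ n).
Proof.
suff [] : is_derive x 1 (primitive_cos n) (cos x ^+ n) /\
   is_derive x 1 (primitive_cos n.+1) (cos x ^+ n.+1) by [].
elim: n => [|n [IH1 IH2]].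
  by split; [exact: is_derive_id|rewrite expr1; exact: is_derive_sin].
split => //.
have -> : primitive_cos n.+2 = (n.+2%:R^-1 : R) *:
    ((sin : R -> R) * ((cos : R -> R) ^+ n.+1) + (n.+1%:R : R) *: primitive_cos n).
  by apply/funext => z; rewrite /= !fctE /GRing.scale/= mulrC.
have h1 := is_deriveM (is_derive_sin x) (is_deriveX n.+1 (is_derive_cos x)).
apply: (is_derive_eq (is_deriveZ _ (is_deriveD h1 (is_deriveZ _ IH1)))).
rewrite /GRing.scale/= exprfctE.
have n2 : n.+2%:R != 0 :> R by rewrite pnatr_eq0.
apply: (mulfI n2); rewrite mulVKf//.
have -> : sin x * (n.+1%:R * cos x ^+ n * - sin x) =
  - (n.+1%:R * cos x ^+ n * sin x ^+ 2) by ring.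
rewrite sin2cos2 !exprS -[n.+2%:R]natr1 -[n.+1%:R]natr1; ring.
Qed.

(** The integral of [cos ^+ n] over [[0, pi / 2]], expressed through its primitive. *)
Definition wallis n : R := primitive_cos n (pi / 2) - primitive_cos n 0.

Lemma wallis0 : wallis 0 = pi / 2.
Proof. by rewrite /wallis subr0. Qed.

Lemma wallis1 : wallis 1 = 1.
Proof. by rewrite /wallis /= sin0 sin_pihalf subr0. Qed.

Lemma wallisSS n : n.+2%:R * wallis n.+2 = n.+1%:R * wallis n.
Proof.
rewrite /wallis /= sin0 cos_pihalf exprS !mul0r mulr0 !add0r; field.
by rewrite ?pnatr_eq0// -?natrD -?mulrS ?nat1r ?natr1 ?pnatr_eq0.
Qed.

Lemma wallis_gt0 n : 0 < wallis n.
Proof.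
suff /andP[] : (0 < wallis n) && (0 < wallis n.+1) by [].
elim: n => [|n /andP[n0 n1]].
  by rewrite wallis0 wallis1 ltr01 divr_gt0// pi_gt0.
by rewrite n1/= -(@pmulr_rgt0 _ n.+2%:R)// wallisSS mulr_gt0.
Qed.

Lemma wallis_noninc n : wallis n.+1 <= wallis n.
Proof.
pose G (z : R) := primitive_cos n z - primitive_cos n.+1 z.
have dG (z : R) : is_derive z 1 G (cos z ^+ n - cos z ^+ n.+1).
  exact: (is_deriveB (is_derive_primitive_cos n z)
                     (is_derive_primitive_cos n.+1 z)).
have pi20 : 0 < pi / 2 :> R by rewrite divr_gt0// pi_gt0.
have [c /andP[c0 c1] E] := MVT_derivable pi20 dG.
suff : 0 <= G (pi / 2) - G 0 by rewrite /wallis /G; lra.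
rewrite E subr0 mulr_ge0 ?(ltW pi20)// exprS.
have cos0 : 0 <= cos c.
  by apply: cos_ge0_pihalf; rewrite (ltW c1) andbT; lra.
have -> : cos c ^+ n - cos c * cos c ^+ n = (1 - cos c) * cos c ^+ n by ring.
by rewrite mulr_ge0 ?exprn_ge0// subr_ge0 cos_le1.
Qed.

(** By the recurrence [wallisSS] the product does not depend on [n]. *)
Lemma wallisM n : n.+1%:R * wallis n * wallis n.+1 = pi / 2.
Proof.
elim: n => [|n IH]; first by rewrite wallis0 wallis1 mul1r mulr1.
by rewrite mulrAC wallisSS -IH; ring.
Qed.

(** The probability that a simple random walk is back at its origin after [2m] steps. *)
Definition central_prob m : R := 'C(m.*2, m)%:R / 4 ^+ m.

Lemma central_probS m :
  central_prob m.+1 * (m.*2.+2)%:R = central_prob m * (m.*2.+1)%:R.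
Proof.
have E : ('C(m.*2.+2, m.+1) * m.+1 = 'C(m.*2, m) * (m.*2.+1) * 2)%N.
  have E1 := mul_bin_diag m.*2.+2 m.
  have E2 := mul_bin_down m.*2.+1 m.
  have Em : (m.*2.+1 - m = m.+1)%N by lia.
  by rewrite /= Em in E1 E2; nia.
have/(congr1 (fun k => k%:R : R)) := E; rewrite !natrM => E'.
rewrite /central_prob doubleS exprS.
have -> : m.*2.+2%:R = m.+1%:R * 2 :> R by rewrite -natrM muln2 doubleS.
have -> : 'C(m.*2.+2, m.+1)%:R = 'C(m.*2, m)%:R * m.*2.+1%:R * 2 / m.+1%:R :> R.
  by rewrite -E' mulfK// pnatr_eq0.
by field; rewrite nat1r pnatr_eq0/= expf_neq0.
Qed.

Lemma wallis_central m : wallis m.*2 = pi / 2 * central_prob m.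
Proof.
elim: m => [|m IH].
  by rewrite wallis0 /central_prob bin0 expr0 divr1 mulr1.
have n2 : m.*2.+2%:R != 0 :> R by rewrite pnatr_eq0.
apply: (mulfI n2); rewrite wallisSS IH.
rewrite (mulrC m.*2.+2%:R) -(mulrA _ _ m.*2.+2%:R) central_probS; ring.
Qed.

Lemma central_prob_ge0 m : 0 <= central_prob m.
Proof. by rewrite divr_ge0 ?exprn_ge0. Qed.

(** The middle term is a multiple of the square of [wallis m.*2]. Monotonicity of [wallis] compares
    this square with products of two consecutive values, which [wallisM] evaluates. *)
Lemma central_prob_bounds m :
  m.*2%:R / m.*2.+1%:R <= pi * m%:R * central_prob m ^+ 2 <= 1.
Proof.
have pi0 := @pi_gt0 R; have w0 := central_prob_ge0 m.
have E : pi * m%:R * central_prob m ^+ 2 = 2 / pi * m.*2%:R * wallis m.*2 ^+ 2.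
  rewrite wallis_central -muln2 natrM.
  by move: pi pi0 => P P0; field; rewrite gt_eqF.
rewrite E; apply/andP; split.
  rewrite ler_pdivrMr//.
  rewrite [leLHS](_ : _ = 2 / pi * m.*2%:R * (pi / 2)); last first.
    by move: (@pi R) pi0 => P P0; field; rewrite gt_eqF.
  rewrite -(wallisM m.*2) -[leRHS]mulrA ler_wpM2l ?mulr_ge0 ?invr_ge0 ?(ltW pi0)//.
  rewrite [leRHS]mulrC expr2 -mulrA.
  by rewrite !ler_wpM2l ?wallis_noninc// ltW// wallis_gt0.
case: m {w0 E} => [|m]; first by rewrite mulr0 mul0r.
rewrite doubleS.
have := wallisM m.*2.+1 => E.
have : wallis m.*2.+2 ^+ 2 * m.*2.+2%:R <= pi / 2.
  rewrite -E mulrC expr2 mulrA ler_wpM2r ?(ltW (wallis_gt0 _))//.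
  by rewrite ler_wpM2l// wallis_noninc.
move=> h; rewrite -mulrA (mulrC m.*2.+2%:R).
rewrite -[leRHS](_ : 2 / pi * (pi / 2) = 1); last first.
  by move: (@pi R) pi0 => P P0; field; rewrite gt_eqF.
by rewrite ler_wpM2l// divr_ge0// ltW.
Qed.

(** The probability that a walk of [2m] steps ends at [2j], relative to that of ending at 0. *)
Definition bin_ratio m j : R := 'C(m.*2, m + j)%:R / 'C(m.*2, m)%:R.

Lemma bin_ratioS m j : (j < m)%N ->
  bin_ratio m j.+1 = bin_ratio m j * ((m - j)%N%:R / (m + j).+1%:R).
Proof.
move=> jm; have E := mul_bin_left m.*2 (m + j).
have Em : (m.*2 - (m + j) = m - j)%N by rewrite -addnn subnDl.
rewrite Em in E; move/(congr1 (fun k => k%:R : R)) : E; rewrite !natrM => E.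
rewrite /bin_ratio addnS.
have -> : 'C(m.*2, (m + j).+1)%:R =
    (m - j)%N%:R * 'C(m.*2, m + j)%:R / (m + j).+1%:R :> R.
  by rewrite -E mulrC mulrA mulVf ?mul1r// pnatr_eq0.
have b0 : 'C(m.*2, m)%:R != 0 :> R.
  by rewrite pnatr_eq0 -lt0n bin_gt0 -addnn leq_addr.
have d0 : (m + j).+1%:R != 0 :> R by rewrite pnatr_eq0.
by move: (m + j).+1%:R d0 => d d0; field; rewrite ?b0 ?d0.
Qed.

Lemma bin_ratio0 m : bin_ratio m 0 = 1.
Proof.
by rewrite /bin_ratio addn0 divff// pnatr_eq0 -lt0n bin_gt0 -addnn leq_addr.
Qed.

Lemma bin_ratio_ge0 m j : 0 <= bin_ratio m j.
Proof. by rewrite divr_ge0. Qed.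

(** The ratio is the product over [i < j] of [1 - (2i+1)/(m+i+1)]. Each factor is at most
    [expR (- (2i+1)/(m+k))], and the odd numbers sum to [j ^ 2]. The auxiliary [k] keeps the
    denominator fixed during the induction. *)
Lemma bin_ratio_ub m j k : (j <= k <= m)%N -> (0 < m)%N ->
  bin_ratio m j <= expR (- (j%:R ^+ 2 / (m + k)%N%:R)).
Proof.
move=> + m0; elim: j => [|j IH] /andP[jk km].
  by rewrite bin_ratio0 expr0n mul0r oppr0 expR0.
have jm : (j < m)%N by rewrite (leq_trans jk).
have d0 : 0 < (m + k)%N%:R :> R by rewrite ltr0n addn_gt0 m0.
rewrite bin_ratioS//.
have -> : - (j.+1%:R ^+ 2 / (m + k)%:R) =
    - (j%:R ^+ 2 / (m + k)%:R) + - ((j.*2.+1)%:R / (m + k)%:R) :> R.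
  rewrite -opprD -mulrDl; congr (- (_ / _)).
  by rewrite -!natrX -natrD; congr _%:R; lia.
rewrite expRD ler_pM ?bin_ratio_ge0 ?divr_ge0//.
  by apply: IH; rewrite (ltnW jk).
have := @expR_ge1Dx R (- (j.*2.+1%:R / (m + k)%:R)).
apply: le_trans.
have -> : (m - j)%:R / (m + j).+1%:R = 1 + - ((j.*2.+1)%:R / (m + j).+1%:R) :> R.
  have -> : (m - j)%N = ((m + j).+1 - j.*2.+1)%N by lia.
  by rewrite natrB; [rewrite mulrBl divff ?pnatr_eq0|lia].
rewrite lerD2l lerN2 ler_wpM2l// lef_pV2 ?posrE// ler_nat; lia.
Qed.

(** Same product, now with inverted factors: [1 + (2i+1)/(m-i)] is at most [expR ((2i+1)/(m-k))]. *)
Lemma bin_ratio_lb m j k : (j <= k < m)%N ->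
  expR (- (j%:R ^+ 2 / (m - k)%N%:R)) <= bin_ratio m j.
Proof.
elim: j => [|j IH] /andP[jk km].
  by rewrite bin_ratio0 expr0n mul0r oppr0 expR0.
have jm : (j < m)%N by rewrite (leq_trans jk)// ltnW.
have d0 : 0 < (m - k)%N%:R :> R by rewrite ltr0n subn_gt0.
rewrite bin_ratioS//.
have -> : - (j.+1%:R ^+ 2 / (m - k)%:R) =
    - (j%:R ^+ 2 / (m - k)%:R) + - ((j.*2.+1)%:R / (m - k)%:R) :> R.
  rewrite -opprD -mulrDl; congr (- (_ / _)).
  by rewrite -!natrX -natrD; congr _%:R; lia.
rewrite expRD ler_pM ?expR_ge0//.
  by apply: IH; rewrite (ltnW jk).
rewrite expRN -[leRHS]invrK lef_pV2 ?posrE ?expR_gt0 ?invr_gt0 ?divr_gt0 ?ltr0n ?subn_gt0//.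
have := @expR_ge1Dx R (j.*2.+1%:R / (m - k)%:R).
apply: le_trans; rewrite invf_div.
have mj0 : 0 < (m - j)%N%:R :> R by rewrite ltr0n subn_gt0.
have -> : (m + j).+1%:R / (m - j)%:R = 1 + (j.*2.+1)%:R / (m - j)%:R :> R.
  have -> : (m + j).+1 = (m - j + j.*2.+1)%N by lia.
  by rewrite natrD mulrDl divff ?gt_eqF.
rewrite lerD2l ler_wpM2l// lef_pV2 ?posrE// ler_nat; lia.
Qed.

End Wallis.

(** * Moments of the walk as integrals of step functions *)

Section WalkMoments.
Context {R : realType}.
Implicit Types (f : R -> R) (p x t : R) (m n j k i : nat).

Lemma iter_avgE f k x :
  iter k (avg 1) f x =
  (\sum_(i < k.+1) 'C(k, i)%:R * f (x + (i.*2%:R - k%:R))) / 2 ^+ k.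
Proof.
elim: k x => [|k IH] x.
  by rewrite big_ord1 /= bin0 mul1r subrr addr0 expr0 divr1.
rewrite iterS /avg !IH -mulrDl exprSr invfM -mulrA; congr (_ * _).
pose F i := f (x + (i.*2%:R - k.+1%:R)).
have E1 : \sum_(i < k.+1) 'C(k, i)%:R * f (x + 1 + (i.*2%:R - k%:R)) =
    \sum_(i < k.+1) 'C(k, i)%:R * F i.+1.
  apply: eq_bigr => i _; congr (_ * f _).
  by rewrite doubleS -!natr1; ring.
have E2 : \sum_(i < k.+1) 'C(k, i)%:R * f (x - 1 + (i.*2%:R - k%:R)) =
    \sum_(i < k.+1) 'C(k, i)%:R * F i.
  apply: eq_bigr => i _; congr (_ * f _).
  by rewrite -[k.+1%:R]natr1; ring.
rewrite E1 E2 [in RHS]big_ord_recl.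
under [in RHS]eq_bigr do rewrite lift0 binS natrD mulrDl.
rewrite big_split/= addrA [in RHS]addrC; congr (_ + _).
rewrite [in LHS]big_ord_recl !bin0; congr (_ + _).
rewrite [in RHS]big_ord_recr/= bin_small// mul0r addr0.
by apply: eq_bigr.
Qed.

Lemma iter_avg_scale (g : R -> R) p h k x : (forall y z, g (y * z) = `|y| `^ p * g z) ->
  iter k (avg h) g (h * x) = `|h| `^ p * iter k (avg 1) g x.
Proof.
move=> gM; elim: k x => [|k IH] x /=; first by rewrite gM.
have avgE h' F z : avg h' F z = (F (z + h') + F (z - h')) / 2 by [].
rewrite !avgE.
have -> : h * x + h = h * (x + 1) by rewrite mulrDr mulr1.
have -> : h * x - h = h * (x - 1) by rewrite mulrBr mulr1.
by rewrite !IH -mulrDr mulrA.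
Qed.

Definition walk_moment p k := iter k (avg 1) (fun x => `|x| `^ p) 0.

Lemma walk_moment_scale p h k :
  iter k (avg h) (fun x => `|x| `^ p) 0 = `|h| `^ p * walk_moment p k.
Proof.
rewrite -{1}(mulr0 h); apply: iter_avg_scale => y z.
by rewrite normrM powRM.
Qed.

Lemma walk_moment_doubleE p m : p != 0 -> walk_moment p m.*2 =
  2 * central_prob m * \sum_(j < m.+1) bin_ratio m j * j.*2%:R `^ p.
Proof.
move=> p0; rewrite /walk_moment iter_avgE.
have -> : 2 ^+ m.*2 = 4 ^+ m :> R by rewrite -mul2n exprM expr2 -natrM.
have C0 : 'C(m.*2, m)%:R != 0 :> R.
  by rewrite pnatr_eq0 -lt0n bin_gt0 -addnn leq_addr.
have -> : 2 * central_prob m * (\sum_(j < m.+1) bin_ratio m j * j.*2%:R `^ p) =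
   (\sum_(j < m.+1) 'C(m.*2, m + j)%:R * j.*2%:R `^ p) * 2 / 4 ^+ m.
  rewrite !mulr_suml mulr_sumr; apply: eq_bigr => j _.
  rewrite /central_prob /bin_ratio.
  move: ('C(_, _)%:R) C0 => c c0; move: ('C(_, _)%:R) => d.
  by field; rewrite c0 expf_neq0.
congr (_ / _).
rewrite -(big_mkord xpredT (fun i => 'C(m.*2, i)%:R * `|0 + (i.*2%:R - m.*2%:R)| `^ p)).
rewrite (@big_cat_nat _ _ _ m)//=; last by rewrite -addnn -addnS leq_addr.
have -> : \sum_(m <= i < m.*2.+1) 'C(m.*2, i)%:R * `|0 + (i.*2%:R - m.*2%:R)| `^ p =
   \sum_(j < m.+1) 'C(m.*2, m + j)%:R * j.*2%:R `^ p.
  rewrite -{1}(add0n m) big_addn -addnn -addnS addKn big_mkord.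
  apply: eq_bigr => j _; rewrite addnC add0r; congr (_ * _ `^ _).
  by rewrite addnn doubleD natrD addrAC subrr add0r ger0_norm.
rewrite mulrDr mulr1; congr (_ + _).
rewrite [RHS]big_ord_recl /= powR0// mulr0 add0r.
rewrite big_nat_rev/= big_mkord; apply: eq_bigr => j _.
rewrite add0n add0r /bump leq0n add1n; have jm := ltn_ord j.
congr (_ * _ `^ _).
  rewrite -[in LHS]bin_sub; last by lia.
  by congr ('C(_, _)%:R); lia.
rewrite -normrN opprB -natrB; last by lia.
by rewrite ger0_norm//; congr _%:R; lia.
Qed.

Definition grid m j : R := j%:R ^+ 2 / m%:R.

Lemma grid_ge0 m j : 0 <= grid m j.
Proof. by rewrite /grid divr_ge0// exprn_ge0. Qed.

(* [m%:R / j.*2.+1%:R] is the inverse length of the [j]-th grid interval, so that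
   the integral of [step_fun p m] is the normalized moment of the walk. *)
Definition step_coef p m j : R :=
  2 * (central_prob m * bin_ratio m j) * (2 * grid m j) `^ (p / 2) *
  (m%:R / j.*2.+1%:R).

Definition step_fun p m t : R :=
  \sum_(j < m.+1) step_coef p m j * \1_(`[grid m j, grid m j.+1[%classic) t.

Lemma grid_itv m t j : (0 < m)%N -> 0 <= t ->
  (t \in `[grid m j, grid m j.+1[) = (Num.truncn (Num.sqrt (m%:R * t)) == j).
Proof.
move=> m0 t0; rewrite truncn_eq ?sqrtr_ge0// in_itv/=.
have mR : 0 < m%:R :> R by rewrite ltr0n.
rewrite /grid ler_pdivrMr// ltr_pdivlMr// (mulrC t).
congr (_ && _).
  rewrite -[in LHS]ler_sqrt; last by rewrite mulr_ge0// ltW.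
  by rewrite sqrtr_sqr ger0_norm.
rewrite -[in LHS]ltr_sqrt; last by rewrite exprn_gt0.
by rewrite sqrtr_sqr ger0_norm.
Qed.

Lemma step_coef0 p m : p != 0 -> step_coef p m 0 = 0.
Proof.
move=> p0; rewrite /step_coef /grid expr0n mul0r mulr0 powR0 ?mulr0 ?mul0r//.
by rewrite mulf_neq0// invr_eq0.
Qed.

Lemma step_coef_ge0 p m j : 0 <= step_coef p m j.
Proof.
by rewrite !mulr_ge0// ?central_prob_ge0 ?bin_ratio_ge0 ?powR_ge0.
Qed.

Lemma step_funE p m t : (0 < m)%N -> 0 <= t ->
  step_fun p m t = step_coef p m (Num.truncn (Num.sqrt (m%:R * t))).
Proof.
move=> m0 t0; set J := Num.truncn _.
have E i : \1_(`[grid m i, grid m i.+1[%classic) t = (J == i)%:R :> R.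
  by rewrite indicE /J -grid_itv// mem_setE.
rewrite /step_fun; have [Jm|Jm] := ltnP J m.+1.
  rewrite (bigD1 (Ordinal Jm))//= E eqxx mulr1 big1 ?addr0// => i iJ.
  by rewrite E; case: eqP => [Ji|_]; rewrite ?mulr0//; case/eqP: iJ; apply: val_inj.
(* For an index above [m] the sum has no matching interval, and the coefficient vanishes too,
   because its binomial coefficient is zero. *)
rewrite big1 => [|i _].
  by rewrite /step_coef /bin_ratio bin_small ?mul0r ?mulr0 ?mul0r// -addnn ltn_add2l.
rewrite E; case: eqP => [Ji|_]; rewrite ?mulr0//.
by move: (ltn_ord i); rewrite -Ji ltnNge Jm.
Qed.

Lemma step_fun_ge0 p m t : 0 <= step_fun p m t.
Proof. by apply: sumr_ge0 => i _; rewrite mulr_ge0 ?step_coef_ge0// indicE. Qed.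

Lemma measurable_step_fun p m : measurable_fun setT (step_fun p m).
Proof.
by apply: measurable_sum => i; apply: measurable_funM => //.
Qed.

Lemma grid_diff m j : (0 < m)%N -> grid m j.+1 - grid m j = j.*2.+1%:R / m%:R.
Proof.
move=> m0; rewrite /grid -mulrBl; congr (_ / _).
by rewrite -addnn -!natr1 natrD; ring.
Qed.

Lemma integral_step_fun p m : p != 0 -> (0 < m)%N ->
  (\int[lebesgue_measure]_(t in `]0%R, +oo[) (step_fun p m t)%:E)%E =
  (walk_moment p m.*2 / m.*2%:R `^ (p / 2))%:E.
Proof.
move=> p0 m0; have mR : m%:R != 0 :> R by rewrite pnatr_eq0 -lt0n.
under eq_integral do rewrite /step_fun -sumEFin.
rewrite ge0_integral_sum//; last 2 first.
- move=> i; apply/measurable_EFinP; apply: measurable_funTS.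
  by apply: measurable_funM => //.
- by move=> i t _; rewrite lee_fin mulr_ge0 ?step_coef_ge0// indicE.
rewrite walk_moment_doubleE// -mulrA mulr_suml mulr_sumr -sumEFin.
(* The interval of index 0 contains the excluded point 0, but its coefficient vanishes; all the
   others lie inside the domain of integration. *)
apply: eq_bigr => -[[|j]/= jm] _.
  under eq_integral do rewrite step_coef0// mul0r.
  by rewrite integral0 powR0// mulr0 mul0r mulr0.
under eq_integral do rewrite EFinM.
rewrite ge0_integralZl//; last 2 first.
- by apply/measurable_EFinP; apply: measurable_funTS; exact: measurable_indic.
- by rewrite lee_fin step_coef_ge0.
rewrite integral_indic//.
rewrite setIidl; last first.
  move=> t /=; rewrite !in_itv/= andbT => /andP[+ _]; apply: lt_le_trans.
  by rewrite divr_gt0 ?exprn_gt0// ltr0n.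
have lt_grid : grid m j.+1 < grid m j.+2.
  by rewrite -subr_gt0 grid_diff// divr_gt0// ltr0n.
rewrite /= lebesgue_measure_itv/= lte_fin lt_grid -EFinB grid_diff// -EFinM.
congr EFin; rewrite /step_coef.
(* With [i = j.+1], this is [(2i)^2 = (2 i^2/m) (2m)] raised to the power [p / 2]. *)
have -> : j.+1.*2%:R `^ p = (2 * grid m j.+1) `^ (p / 2) * m.*2%:R `^ (p / 2) :> R.
  rewrite -powRM// ?mulr_ge0// ?divr_ge0 ?exprn_ge0//.
  have -> : 2 * grid m j.+1 * m.*2%:R = j.+1.*2%:R `^ 2.
    by rewrite powR_mulrn// /grid -!muln2 !natrM; field.
  by rewrite -powRrM; congr (_ `^ _); field.
have M0 : m.*2%:R `^ (p / 2) != 0 :> R.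
  by rewrite gt_eqF// powR_gt0// ltr0n double_gt0.
have J0 : j.+1.*2.+1%:R != 0 :> R by rewrite pnatr_eq0.
move: (_ `^ (p / 2)) M0 => M M0; move: (_.+1%:R) J0 => J J0.
by field; rewrite M0 J0 mR.
Qed.

End WalkMoments.

(** * Pointwise limit of the step functions *)

Section MomentLimit.
Context {R : realType}.
Implicit Types (p x t : R) (m n j k i : nat).

Let em n : R := (Num.sqrt n.+1%:R)^-1.

Let cvg_em : em n @[n --> \oo] --> (0 : R).
Proof.
have -> : em = Num.sqrt \o harmonic.
  by apply/funext => n; rewrite /em /= sqrtrV.
rewrite -[X in _ --> X](@sqrtr0 R); apply: continuous_cvg.
  exact: sqrt_continuous.
exact: cvg_harmonic.
Qed.

Let sqrtn_gt0 n : 0 < Num.sqrt n.+1%:R :> R.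
Proof. by rewrite sqrtr_gt0 ltr0n. Qed.

(** The middle term [x] lies in [[0, 1]], so [x ^+ 2 <= x] and the lower bound of
    [central_prob_bounds] passes to [x] without a root. *)
Lemma sqrt_central_bounds n :
  1 - n.+1%:R^-1 <= Num.sqrt (@pi R) * (Num.sqrt n.+1%:R * central_prob n.+1) <= 1.
Proof.
have /andP[lb ub] := central_prob_bounds (R := R) n.+1.
have c0 := central_prob_ge0 (R := R) n.+1.
set x := Num.sqrt pi * _.
have x0 : 0 <= x by rewrite !mulr_ge0 ?sqrtr_ge0.
have x2 : pi * n.+1%:R * central_prob n.+1 ^+ 2 = x ^+ 2.
  by rewrite /x !exprMn !sqr_sqrtr ?pi_ge0// mulrA.
rewrite x2 in lb ub.
have x1 : x <= 1 by rewrite -(@ler_pXn2r _ 2) ?nnegrE ?expr1n.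
rewrite x1 andbT; apply: (@le_trans _ _ (x ^+ 2)); last first.
  by rewrite expr2; apply: ler_piMl.
apply: le_trans lb.
have -> : n.+1.*2%:R / n.+1.*2.+1%:R = 1 - n.+1.*2.+1%:R^-1 :> R.
  have d0 : n.+1.*2.+1%:R != 0 :> R by rewrite pnatr_eq0.
  by apply: (mulIf d0); rewrite mulrBl divfK// mulVf// mul1r -natr1 addrK.
by rewrite lerD2l lerN2 lef_pV2 ?posrE ?ltr0n// ler_nat; lia.
Qed.

Lemma cvg_sqrt_central :
  Num.sqrt n.+1%:R * central_prob n.+1 @[n --> \oo] --> (Num.sqrt (@pi R))^-1.
Proof.
have pi0 : 0 < Num.sqrt pi :> R by rewrite sqrtr_gt0 pi_gt0.
have : Num.sqrt pi * (Num.sqrt n.+1%:R * central_prob n.+1) @[n --> \oo] --> (1 : R).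
  apply: (@squeeze_cvgr _ _ _ _ (fun n => 1 - n.+1%:R^-1) (cst 1)).
  - by near=> n; exact: sqrt_central_bounds.
  - rewrite -[X in _ --> X]subr0; apply: cvgB; [exact: cvg_cst|exact: cvg_harmonic].
  - exact: cvg_cst.
move=> h.
rewrite (_ : (fun n => _) = fun n => (Num.sqrt (@pi R))^-1 *
    (Num.sqrt pi * (Num.sqrt n.+1%:R * central_prob n.+1))); last first.
  by apply/funext => n; rewrite mulKf// gt_eqF.
rewrite -[X in _ --> X]mulr1; apply: cvgM => //; exact: cvg_cst.
Unshelve. all: by end_near. Qed.

Section pointwise.
Variables (p t : R).
Hypothesis t_gt0 : 0 < t.

Let J n := Num.truncn (Num.sqrt (n.+1%:R * t)).
Let r n : R := (J n)%:R * em n.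

Let st_gt0 : 0 < Num.sqrt t. Proof. by rewrite sqrtr_gt0. Qed.

Let emK n : Num.sqrt n.+1%:R * em n = 1.
Proof. by rewrite /em divff// gt_eqF. Qed.

Let em_gt0 n : 0 < em n. Proof. by rewrite invr_gt0. Qed.

Let em2 n : em n ^+ 2 = n.+1%:R^-1.
Proof. by rewrite /em exprVn sqr_sqrtr. Qed.

Let J_bounds n : (J n)%:R <= Num.sqrt n.+1%:R * Num.sqrt t < (J n).+1%:R.
Proof. by rewrite -sqrtrM//; apply: truncn_itv; exact: sqrtr_ge0. Qed.

(** Truncation loses less than 1, hence less than [em n] after scaling. *)
Let cvg_r : r n @[n --> \oo] --> Num.sqrt t.
Proof.
apply: (@squeeze_cvgr _ _ _ _ (fun n => Num.sqrt t - em n) (cst (Num.sqrt t))).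
- near=> n; have /andP[h1 h2] := J_bounds n.
  have e0 := em_gt0 n; have E := emK n.
  have -> : Num.sqrt t = Num.sqrt n.+1%:R * Num.sqrt t * em n.
    by rewrite mulrAC E mul1r.
  rewrite /r /cst ler_pM2r// h1 andbT lerBlDr -[X in _ <= _ + X]mul1r -mulrDl.
  by rewrite ler_pM2r// natr1 ltW.
- by rewrite -[X in _ --> X]subr0; apply: cvgB; [exact: cvg_cst|exact: cvg_em].
- exact: cvg_cst.
Unshelve. all: by end_near. Qed.

Let grid_r n : grid n.+1 (J n) = r n ^+ 2.
Proof. by rewrite /grid /r exprMn em2. Qed.

Let cvg_grid : grid n.+1 (J n) @[n --> \oo] --> t.
Proof.
rewrite (_ : (fun n => _) = (fun n => r n * r n)); last first.
  by apply/funext => n; rewrite grid_r expr2.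
rewrite -[X in _ --> X](sqr_sqrtr (ltW t_gt0)) expr2.
by apply: cvgM; exact: cvg_r.
Qed.

Let near_J : \forall n \near \oo, (J n < n.+1)%N.
Proof.
near=> n; rewrite -(ltr_nat R); have /andP[h _] := J_bounds n.
apply: le_lt_trans h _; rewrite -[ltRHS]sqr_sqrtr// expr2 ltr_pM2l//.
rewrite ltr_sqrt// (@lt_trans _ _ n%:R)// ?ltr_nat//.
by near: n; exact: nbhs_infty_gtr.
Unshelve. all: by end_near. Qed.

(** Squeeze between the two exponential bounds taken at [k = J n]. Their exponents are
    [grid n.+1 (J n)] divided by [1 - r n * em n] and [1 + r n * em n], and both tend to [t]. *)
Let cvg_ratio : bin_ratio n.+1 (J n) @[n --> \oo] --> expR (- t).
Proof.
have re0 : r n * em n @[n --> \oo] --> 0.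
  by rewrite -[X in _ --> X](mulr0 (Num.sqrt t)); apply: cvgM.
have c1 : grid n.+1 (J n) / (1 - r n * em n) @[n --> \oo] --> t.
  rewrite -[X in _ --> X]mulr1; apply: cvgM => //.
  rewrite -[X in _ --> X]invr1; apply: cvgV; first by rewrite oner_eq0.
  by rewrite -[X in _ --> X]subr0; apply: cvgB => //; exact: cvg_cst.
have c2 : grid n.+1 (J n) / (1 + r n * em n) @[n --> \oo] --> t.
  rewrite -[X in _ --> X]mulr1; apply: cvgM => //.
  rewrite -[X in _ --> X]invr1; apply: cvgV; first by rewrite oner_eq0.
  by rewrite -[X in _ --> X]addr0; apply: cvgD => //; exact: cvg_cst.
have ce (u : nat -> R) : u n @[n --> \oo] --> t ->
    expR (- u n) @[n --> \oo] --> expR (- t).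
  move=> ut; apply: continuous_cvg; first exact: continuous_expR.
  exact: cvgN.
apply: (@squeeze_cvgr _ _ _ _ _ _ _ _ _ (ce _ c1) (ce _ c2)).
near=> n; have Jn : (J n < n.+1)%N by near: n.
have n0 : n.+1%:R != 0 :> R by rewrite pnatr_eq0.
have rE : r n * em n = (J n)%:R / n.+1%:R by rewrite /r -mulrA -expr2 em2.
have -> : grid n.+1 (J n) / (1 - r n * em n) = (J n)%:R ^+ 2 / (n.+1 - J n)%N%:R.
  rewrite /grid rE natrB; last exact: ltnW.
  have d0 : n.+1%:R - (J n)%:R != 0 :> R by rewrite gt_eqF// subr_gt0 ltr_nat.
  by move: n.+1%:R (J n)%:R n0 d0 => x y x0 d0; field; rewrite x0 d0.
have -> : grid n.+1 (J n) / (1 + r n * em n) = (J n)%:R ^+ 2 / (n.+1 + J n)%N%:R.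
  rewrite /grid rE natrD.
  have d0 : n.+1%:R + (J n)%:R != 0 :> R by rewrite -natrD pnatr_eq0.
  by move: n.+1%:R (J n)%:R n0 d0 => x y x0 d0; field; rewrite x0 d0.
by rewrite bin_ratio_lb ?bin_ratio_ub ?leqnn// ltnW.
Unshelve. all: by end_near. Qed.

Lemma cvg_step_fun : step_fun p n.+1 t @[n --> \oo] -->
  2 * ((Num.sqrt pi)^-1 * expR (- t)) * (2 * t) `^ (p / 2) * (2 * Num.sqrt t)^-1.
Proof.
(* Half of the factor [n.+1] goes to [central_prob], the other half to the inverse interval length,
   so that every factor converges separately. *)
have -> : (fun n => step_fun p n.+1 t) = (fun n =>
    2 * ((Num.sqrt n.+1%:R * central_prob n.+1) * bin_ratio n.+1 (J n)) *
    (2 * grid n.+1 (J n)) `^ (p / 2) * (2 * r n + em n)^-1).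
  apply/funext => n; rewrite step_funE ?(ltW t_gt0)// -/(J n) /step_coef.
  have -> : n.+1%:R / (J n).*2.+1%:R = Num.sqrt n.+1%:R * (2 * r n + em n)^-1.
    have -> : 2 * r n + em n = (J n).*2.+1%:R * em n.
      by rewrite /r mulrA -natrM mul2n -[X in _ + X]mul1r -mulrDl natr1.
    rewrite -[X in X / _](@sqr_sqrtr _ n.+1%:R)// /em invfM invrK expr2.
    by rewrite -mulrA; congr (_ * _); rewrite mulrC.
  ring.
apply: cvgM; [apply: cvgM; [apply: cvgM; [exact: cvg_cst|apply: cvgM]|]|].
- exact: cvg_sqrt_central.
- exact: cvg_ratio.
- have t2 : 0 < 2 * t by rewrite mulr_gt0.
  apply: (@continuous_cvg _ _ _ _ _ _ (fun x => x `^ (p / 2))).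
    have [h _] := is_derive1_powR (p / 2) t2.
    exact/differentiable_continuous/derivable1_diffP.
  by apply: cvgM => //; exact: cvg_cst.
- apply: cvgV; first by rewrite gt_eqF// mulr_gt0.
  rewrite -[X in _ --> X]addr0; apply: cvgD => //.
  by apply: cvgM => //; exact: cvg_cst.
Qed.

End pointwise.

End MomentLimit.

(** * Domination and the limit of the normalized moments *)

Section DominatedLimit.
Context {R : realType}.
Implicit Types (p x t : R) (m n j k i : nat).

(** The inequality [u <= expR u] at [u = x / b], raised to the power [b]. *)
Lemma powR_le_expR x b : 0 <= x -> 0 < b -> x `^ b <= b `^ b * expR x.
Proof.
move=> x0 b0; have xb0 : 0 <= x / b by rewrite divr_ge0// ltW.
have bx : x / b <= expR (x / b) by rewrite (le_trans _ (expR_ge1Dx _))// lerDr.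
have E : x = b * (x / b) by rewrite mulrC divfK// gt_eqF.
rewrite {1}E powRM ?(ltW b0)// ler_wpM2l ?powR_ge0//.
have -> : expR x = expR (x / b) `^ b.
  by rewrite /powR gt_eqF ?expR_gt0// expRK -E.
by apply: ge0_ler_powR; rewrite ?nnegrE ?expR_ge0// ltW.
Qed.

Lemma step_fun_le p t n : 1 < p -> 0 < t ->
  step_fun p n.+1 t <= 2 * Num.sqrt 2 * (2 * t) `^ ((p - 1) / 2) * expR (- (t / 8)).
Proof.
move=> p1 t0; rewrite step_funE ?(ltW t0)//; set J := Num.truncn _.
have rhs0 : 0 <= 2 * Num.sqrt 2 * (2 * t) `^ ((p - 1) / 2) * expR (- (t / 8)).
  by rewrite !mulr_ge0 ?sqrtr_ge0 ?powR_ge0 ?expR_ge0.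
have sm0 : 0 < Num.sqrt n.+1%:R :> R by rewrite sqrtr_gt0 ltr0n.
have st0 : 0 < Num.sqrt t by rewrite sqrtr_gt0.
have p0 : p != 0 by rewrite gt_eqF// (lt_trans _ p1).
have [J0|J0] := posnP J; first by rewrite J0 step_coef0.
have [Jn|Jn] := ltnP n.+1 J.
  by rewrite /step_coef /bin_ratio bin_small ?mul0r ?mulr0 ?mul0r// -addnn ltn_add2l.
have : t \in `[grid n.+1 J, grid n.+1 J.+1[ by rewrite grid_itv// ltW.
rewrite in_itv/= => /andP[gt tg].
have g0 := grid_ge0 (R := R) n.+1 J.
(* For [J >= 1] one has [J + 1 <= 2 J], so the right end of the interval is at most four times its
   left end. *)
have t4 : t <= 4 * grid n.+1 J.
  rewrite (le_trans (ltW tg))// /grid mulrA ler_pM2r ?invr_gt0 ?ltr0n//.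
  by rewrite -!natrX -natrM ler_nat; nia.
have /andP[_ J2] : J%:R <= Num.sqrt n.+1%:R * Num.sqrt t < J.+1%:R.
  by rewrite -sqrtrM//; apply: truncn_itv; exact: sqrtr_ge0.
have c1 : Num.sqrt n.+1%:R * central_prob n.+1 <= 1 :> R.
  have /andP[_] := sqrt_central_bounds (R := R) n.
  apply: le_trans; apply: ler_peMl; first by rewrite mulr_ge0 ?central_prob_ge0 ?sqrtr_ge0.
  by rewrite -[leLHS]sqrtr1 ler_wsqrtr// (le_trans _ (pi_ge2 R)) ?ler1n.
(* Taking [k = n.+1] in [bin_ratio_ub] gives the exponent [grid n.+1 J / 2], which is at least
   [t / 8] by [t4]. *)
have c2 : bin_ratio n.+1 J <= expR (- (t / 8)).
  have := @bin_ratio_ub R n.+1 J n.+1; rewrite Jn leqnn => /(_ isT isT).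
  move/le_trans; apply; rewrite ler_expR lerN2.
  have -> : J%:R ^+ 2 / (n.+1 + n.+1)%:R = grid n.+1 J / 2 :> R.
    by rewrite /grid -[RHS]mulrA -invfM; congr (_ * _^-1); rewrite natrD; ring.
  by move: t4; move: (grid _ _) => z; lra.
have c3 : Num.sqrt n.+1%:R / J.*2.+1%:R <= (Num.sqrt t)^-1 :> R.
  rewrite ler_pdivrMr ?ltr0n// mulrC ler_pdivlMr//.
  by rewrite (le_trans (ltW J2))// ler_nat ltnS -addnn leq_addr.
have -> : (2 * t) `^ ((p - 1) / 2) = (2 * t) `^ (p / 2) * (Num.sqrt (2 * t))^-1.
  have -> : (p - 1) / 2 = p / 2 - 2^-1 by field.
  by rewrite powRB ?powR12_sqrt ?mulr_ge0 ?(ltW t0)// mulf_neq0 ?implybT// gt_eqF.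
rewrite sqrtrM// /step_coef.
have -> : n.+1%:R = Num.sqrt n.+1%:R * Num.sqrt n.+1%:R :> R by rewrite -expr2 sqr_sqrtr.
have s20 : 0 < Num.sqrt 2 :> R by rewrite sqrtr_gt0.
have -> : 2 * Num.sqrt 2 * ((2 * t) `^ (p / 2) * (Num.sqrt 2 * Num.sqrt t)^-1) *
  expR (- (t / 8)) = 2 * (1 * expR (- (t / 8))) * (2 * t) `^ (p / 2) * (Num.sqrt t)^-1.
  by rewrite invfM; move: s20 st0; move: (Num.sqrt 2) (Num.sqrt t) => a b a0 b0;
    field; rewrite !gt_eqF.
have -> : 2 * (central_prob n.+1 * bin_ratio n.+1 J) * (2 * grid n.+1 J) `^ (p / 2) *
  (Num.sqrt n.+1%:R * Num.sqrt n.+1%:R / J.*2.+1%:R) =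
  2 * (Num.sqrt n.+1%:R * central_prob n.+1 * bin_ratio n.+1 J) *
  (2 * grid n.+1 J) `^ (p / 2) * (Num.sqrt n.+1%:R / J.*2.+1%:R) by ring.
have cp0 := central_prob_ge0 (R := R) n.+1.
have br0 := bin_ratio_ge0 (R := R) n.+1 J.
apply: ler_pM => //; first by rewrite !mulr_ge0 ?powR_ge0// ltW.
apply: ler_pM; rewrite ?powR_ge0 ?mulr_ge0 ?(ltW sm0)//.
  by rewrite ler_pM2l// ler_pM ?mulr_ge0 ?(ltW sm0).
apply: ge0_ler_powR; rewrite ?nnegrE ?mulr_ge0 ?(ltW t0)//.
  by rewrite (le_trans _ (ltW p1)).
by rewrite ler_pM2l.
Qed.

Lemma step_fun_dominated p : 1 < p -> exists2 C : R, 0 <= C &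
  forall n t, 0 < t -> step_fun p n.+1 t <= C * exponential_pdf 16^-1 t.
Proof.
move=> p1; have b0 : 0 < (p - 1) / 2 by rewrite divr_gt0// subr_gt0.
set b := (p - 1) / 2 in b0.
(* [expR (- (t / 8))] is the square of [expR (- (t / 16))]: one factor absorbs the power of
   [2 * t = 32 * (t / 16)], the other is the exponential density up to its normalization 16. *)
exists (2 * Num.sqrt 2 * 32 `^ b * b `^ b * 16).
  by rewrite !mulr_ge0 ?sqrtr_ge0 ?powR_ge0.
move=> n t t0; apply: (le_trans (step_fun_le n p1 t0)).
rewrite exponential_pdfE ?(ltW t0)// -/b.
have -> : 2 * t = 32 * (t / 16) by field.
have t16 : 0 <= t / 16 by rewrite divr_ge0// ltW.
rewrite powRM//.
have -> : expR (- (t / 8)) = expR (- (t / 16)) * expR (- (t / 16)).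
  by rewrite -expRD; congr expR; field.
have -> : 2 * Num.sqrt 2 * 32 `^ b * b `^ b * 16 * (16^-1 * expR (- 16^-1 * t)) =
  2 * Num.sqrt 2 * (32 `^ b * (b `^ b * expR (t / 16))) *
  (expR (- (t / 16)) * expR (- (t / 16))).
  have -> : - 16^-1 * t = - (t / 16) by rewrite mulNr mulrC.
  have e0 : expR (t / 16) * expR (- (t / 16)) = 1 by rewrite expRxMexpNx_1.
  move: e0; move: (expR (- _)) (expR (t / 16)) => u v e0.
  have -> : 2 * Num.sqrt 2 * (32 `^ b * (b `^ b * v)) * (u * u) =
    2 * Num.sqrt 2 * (32 `^ b * b `^ b) * (v * u) * u by ring.
  by rewrite e0; field.
rewrite ler_wpM2r ?mulr_ge0 ?expR_ge0// ler_wpM2l ?mulr_ge0 ?sqrtr_ge0//.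
by rewrite ler_wpM2l ?powR_ge0// powR_le_expR.
Qed.

(** The absolute moment of order [p] of a standard Gaussian variable. *)
Definition gauss_moment p : R :=
  2 `^ (p / 2) / Num.sqrt pi * Gamma ((p + 1) / 2).

(** Dominated convergence for the step functions divided by [K], a normalization for which the
    pointwise limit is exactly the integrand of [Gamma ((p + 1) / 2)]. *)
Lemma cvg_walk_moment p : 1 < p ->
  walk_moment p n.+1.*2 / n.+1.*2%:R `^ (p / 2) @[n --> \oo] --> gauss_moment p.
Proof.
move=> p1; have p0 : p != 0 by rewrite gt_eqF// (lt_trans _ p1).
set K : R := 2 `^ (p / 2) / Num.sqrt pi.
have K0 : 0 < K by rewrite divr_gt0 ?powR_gt0// sqrtr_gt0 pi_gt0.
pose g t := t `^ ((p + 1) / 2 - 1) * expR (- t).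
have [C C0 domC] := step_fun_dominated p1.
pose D : set R := `]0, +oo[%classic.
have mexp : measurable_fun setT (fun t : R => expR (- t)).
  by apply: measurableT_comp.
have mg : measurable_fun D (EFin \o g).
  apply/measurable_EFinP; apply: measurable_funTS; apply: measurable_funM.
    exact: measurable_powR.
  exact: mexp.
have mD : measurable D by exact: measurable_itv.
have [] := @dominated_convergence _ _ R lebesgue_measure D mD
  (fun n t => (K^-1 * step_fun p n.+1 t)%:E) (EFin \o g)
  (fun t => (K^-1 * (C * exponential_pdf 16^-1 t))%:E) _ mg.
- move=> n; apply/measurable_EFinP; apply: measurable_funTS; apply: measurable_funM => //.
  exact: measurable_step_fun.
- apply: aeW => t; rewrite /D/= in_itv/= andbT => t0.
  apply: cvg_EFin; first by near=> n.
  have -> : g t = K^-1 * (2 * ((Num.sqrt pi)^-1 * expR (- t)) * (2 * t) `^ (p / 2) *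
    (2 * Num.sqrt t)^-1).
    rewrite /g /K powRM ?(ltW t0)//.
    have -> : (p + 1) / 2 - 1 = p / 2 - 2^-1 by field.
    rewrite powRB; last by rewrite (gt_eqF t0) implybT.
    rewrite powR12_sqrt ?(ltW t0)//.
    have : 0 < Num.sqrt pi :> R by rewrite sqrtr_gt0 pi_gt0.
    have : 0 < Num.sqrt t :> R by rewrite sqrtr_gt0.
    have : 0 < 2 `^ (p / 2) :> R by rewrite powR_gt0.
    move: (2 `^ _) (Num.sqrt t) (Num.sqrt pi) => x y z x0 y0 z0.
    by field; rewrite !gt_eqF.
  apply: cvgM; first exact: cvg_cst.
  exact: cvg_step_fun.
- rewrite (_ : (fun t => _) =
      (fun t => K^-1%:E * (C%:E * (EFin \o exponential_pdf 16^-1) t))%E); last first.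
    by apply/funext.
  apply: integrableZl => //; apply: integrableZl => //.
  apply: (integrableS measurableT) => //.
  by apply: integrable_exponential_pdf; rewrite invr_gt0.
- apply: aeW => t n; rewrite /D/= in_itv/= andbT => t0.
  rewrite ger0_norm ?mulr_ge0 ?invr_ge0 ?(ltW K0) ?step_fun_ge0// lee_fin.
  by rewrite ler_pM2l ?invr_gt0// domC.
move=> ig _ cv.
have -> : gauss_moment p = K * Gamma ((p + 1) / 2) by [].
have E n : (\int[lebesgue_measure]_(t in D) (K^-1 * step_fun p n.+1 t)%:E)%E =
    (K^-1 * (walk_moment p n.+1.*2 / n.+1.*2%:R `^ (p / 2)))%:E.
  under eq_integral do rewrite EFinM.
  rewrite ge0_integralZl//; first by rewrite integral_step_fun.
  - apply/measurable_EFinP; apply: measurable_funTS; exact: measurable_step_fun.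
  - by move=> t _; rewrite lee_fin step_fun_ge0.
  - by rewrite lee_fin invr_ge0 ltW.
have {}cv : K^-1 * (walk_moment p n.+1.*2 / n.+1.*2%:R `^ (p / 2)) @[n --> \oo] -->
    Gamma ((p + 1) / 2).
  have : (K^-1 * (walk_moment p n.+1.*2 / n.+1.*2%:R `^ (p / 2)))%:E @[n --> \oo] -->
      (Gamma ((p + 1) / 2))%:E.
    rewrite /Gamma /Rintegral fineK; last exact: integrable_fin_num.
    by move: cv; under eq_fun do rewrite E.
  by move/fine_cvg.
rewrite (_ : (fun n => _) = (fun n => K * (K^-1 *
    (walk_moment p n.+1.*2 / n.+1.*2%:R `^ (p / 2))))); last first.
  by apply/funext => n; rewrite mulVKf// gt_eqF.
by apply: cvgM => //; exact: cvg_cst.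
Unshelve. all: by end_near. Qed.

End DominatedLimit.

(** * The upper bound *)

Section BlockFunctions.
Context disp (T : measurableType disp) (R : realType) (mu : probability T R).
Variable D : nat -> set (set T).
Hypothesis Dfilt : discrete_filtration mu D.
Implicit Types (k i n : nat) (V W : set T).

(** A pointwise substitute for measurability with respect to [<<s D k >>]. The codomain is arbitrary
    so as to cover propositions and step counts as well. *)
Definition block_const (U : Type) k (F : T -> U) :=
  forall V x y, D k V -> V x -> V y -> F x = F y.

Lemma block_of k x : exists2 V, D k V & V x.
Proof.
have [cov _ _] := dfilt_partition Dfilt k.
by have : [set: T] x by []; rewrite -cov => -[V DV Vx]; exists V.
Qed.

Lemma block_eq k V W x : D k V -> D k W -> V x -> W x -> V = W.
Proof.
by have [_ triv _] := dfilt_partition Dfilt k; move=> DV DW Vx Wx; apply: triv => //; exists x.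
Qed.

Lemma block_sub k W : D k.+1 W -> exists2 V, D k V & W `<=` V.
Proof.
move=> DW; have [_ _ /(_ _ DW) [x Wx]] := dfilt_partition Dfilt k.+1.
have [V DV Vx] := block_of k x; exists V => //.
have [A AD VA] := dfilt_refine Dfilt DV.
have : V x by []; rewrite [in X in X -> _]VA => -[W' AW' W'x].
rewrite (block_eq DW (AD _ AW') Wx W'x) VA => z W'z; by exists W'.
Qed.

Lemma block_constS (U : Type) k (F : T -> U) :
  block_const k F -> block_const k.+1 F.
Proof.
by move=> cF W x y /block_sub[V DV WV] /WV Vx /WV Vy; exact: (cF V).
Qed.

Lemma block_const_le (U : Type) i k (F : T -> U) : (i <= k)%N ->
  block_const i F -> block_const k F.
Proof.
move=> ik cF; rewrite -(subnK ik); elim: (k - i)%N => // j; exact: block_constS.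
Qed.

(** The sets that separate no two points of a block form a sigma-algebra containing [D k]; it
    therefore contains the fibres of [f]. *)
Lemma adapted_block_const k (f : T -> R) :
  measurable_fun [set: g_sigma_algebraType (D k)] f -> block_const k f.
Proof.
move=> mf V x y DV Vx Vy.
pose G := [set S : set T | forall W u v, D k W -> W u -> W v -> S u -> S v].
have GS : <<s D k >> `<=` G.
  apply: smallest_sub => [|S DS W u v DW Wu Wv Su]; last first.
    by rewrite -(block_eq DW DS Wu Su).
  split => [W u v _ _ _ []//|S GS W u v DW Wu Wv [_ Su]|F GF W u v DW Wu Wv [j _ Fu]].
    by split => // Sv; apply: Su; exact: (GS W v).
  by exists j => //; exact: (GF j W u).
have : measurable ([set: g_sigma_algebraType (D k)] `&` f @^-1` [set f x]).
  by apply: mf; [exact: measurableT|exact: measurable_set1].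
by rewrite setTI => /GS /(_ V x y DV Vx Vy erefl) /= ->.
Qed.

(** Every preimage is a union of blocks, and there are countably many blocks. *)
Lemma block_const_adapted d' (U : measurableType d') k (F : T -> U) :
  block_const k F -> measurable_fun [set: g_sigma_algebraType (D k)] F.
Proof.
move=> cF _ Y mY; rewrite setTI.
have -> : F @^-1` Y = \bigcup_(V in [set V | D k V /\ V `<=` F @^-1` Y]) V.
  apply/seteqP; split => x /=; last by move=> [V [_ VY] Vx]; exact: VY.
  move=> FxY; have [V DV Vx] := block_of k x; exists V => //; split => // y Vy.
  by rewrite /= (cF V y x).
rewrite bigcup_set_type.
apply: (@countable_bigcupT_measurable _ (g_sigma_algebraType (D k))).
  rewrite (eq_countable (card_setT _)).
  apply: sub_countable (dfilt_countable Dfilt k).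
  by apply: subset_card_le => V [].
by move=> V; apply: sub_sigma_algebra; have [] := set_valP V.
Qed.

Lemma block_const_measurable d' (U : measurableType d') k (F : T -> U) :
  block_const k F -> measurable_fun setT F.
Proof.
move=> /block_const_adapted mF _ Y mY.
exact: (dfilt_sigma_sub Dfilt (mF measurableT _ mY)).
Qed.

Lemma ge0_integral_le_blocks k (F G : T -> \bar R) :
  measurable_fun setT F -> measurable_fun setT G ->
  (forall x, 0 <= F x)%E -> (forall x, 0 <= G x)%E ->
  (forall V, D k V -> \int[mu]_(x in V) F x <= \int[mu]_(x in V) G x)%E ->
  (\int[mu]_x F x <= \int[mu]_x G x)%E.
Proof.
move=> mF mG F0 G0 FG.
have /countable_injP[c cinj] := dfilt_countable Dfilt k.
(* [E] enumerates the blocks along the injection [c], with the empty set at the integers that [c]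
   does not reach. *)
pose E j := \bigcup_(V in [set V | D k V /\ c V = j]) V.
have EV V : D k V -> E (c V) = V.
  move=> DV; apply/seteqP; split => [x [W [DW cW] Wx]|x Vx].
    by rewrite -(cinj W V) ?inE.
  by exists V.
have Edec j : (exists2 V, D k V & E j = V) \/ E j = set0.
  have [[V [DV cV]]|nV] := pselect (exists V, D k V /\ c V = j).
    by left; exists V; rewrite -?cV ?EV.
  right; rewrite -subset0 => x [V [DV cV] _]; by apply: nV; exists V.
have ET : \bigcup_j E j = setT.
  rewrite -subTset => x _; have [V DV Vx] := block_of k x.
  by exists (c V) => //; rewrite EV.
have Etriv : trivIset setT E.
  move=> i j _ _ [x [[V [DV <-] Vx] [W [DW <-] Wx]]].
  by rewrite (block_eq DV DW Vx Wx).
have mE j : measurable (E j).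
  by have [[V DV ->]|->] := Edec j; [exact: (dfilt_measurable Dfilt DV)|].
rewrite -ET !ge0_integral_bigcup ?ET//.
apply: lee_nneseries => [j _ _|j _]; first exact: integral_ge0.
have [[V DV ->]|->] := Edec j; first exact: FG.
by rewrite !integral_set0.
Qed.

End BlockFunctions.

(** * Domination of a martingale by a simple random walk *)

Section MartingaleBound.
Context disp (T : measurableType disp) (R : realType) (mu : probability T R).
Variable D : nat -> set (set T).
Hypothesis Dfilt : discrete_filtration mu D.
Variables (n : nat) (d b : nat -> T -> R).
Hypothesis d_int : forall i, (i < n)%N -> mu.-integrable [set: T] (EFin \o d i).
Hypothesis d_const : forall i, (i < n)%N -> block_const D i.+1 (d i).
Hypothesis d_mean0 : forall i V, (i < n)%N -> D i V ->
  (\int[mu]_(x in V) (d i x)%:E = 0)%E.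
Hypothesis b_const : forall i, (i < n)%N -> block_const D i (b i).
Hypothesis d_le_b : forall i x, (i < n)%N -> `|d i x| <= b i x.
Variable p : R.
Hypothesis p3 : 3 <= p.
Implicit Types (i k : nat) (x : T).

Let f (z : R) := `|z| `^ p.
Let cf : cvx f. Proof. by apply: cvx_norm_powR; rewrite (le_trans _ p3)// ler1n. Qed.
Let sf : sqcvx f. Proof. exact: sqcvx_norm_powR. Qed.

Section steps.
Variables (h : R) (K : nat).
Hypothesis h_gt0 : 0 < h.

(* The number of symmetric steps of size [h] spent on the increment [d i]. *)
Let nsteps i x := (Num.truncn (b i x ^+ 2 / h ^+ 2)).+1.
Let M k x := \sum_(i < k) d i x.
Let N k x := (\sum_(i < k) nsteps i x)%N.
Hypothesis N_le : forall x, (N n x <= K)%N.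

Let N_mono k x : (k <= n)%N -> (N k x <= K)%N.
Proof.
move=> kn; apply: leq_trans (N_le x); rewrite /N -(subnKC kn) big_split_ord/=.
exact: leq_addr.
Qed.

(** The first [k] increments have been performed, and what remains of the budget of [K] steps is
    spent on symmetric steps. [Phi 0] is the moment of the pure walk, and the integral of [Phi k]
    decreases with [k]. *)
Let Phi k x := iter (K - N k x) (avg h) f (M k x).

Let M_const k : (k <= n)%N -> block_const D k (M k).
Proof.
move=> kn V x y DV Vx Vy; apply: eq_bigr => i _.
have i_n : (i < n)%N := leq_trans (ltn_ord i) kn.
exact: (block_const_le Dfilt (ltn_ord i) (d_const i_n) DV Vx Vy).
Qed.

Let N_const k : (k <= n)%N -> block_const D k (N k).
Proof.
move=> kn V x y DV Vx Vy; apply: eq_bigr => i _.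
have i_n : (i < n)%N := leq_trans (ltn_ord i) kn.
rewrite /nsteps.
by rewrite (block_const_le Dfilt (ltnW (ltn_ord i)) (b_const i_n) DV Vx Vy).
Qed.

Let Phi_const k : (k <= n)%N -> block_const D k (Phi k).
Proof.
move=> kn V x y DV Vx Vy.
by rewrite /Phi (M_const kn DV Vx Vy) (N_const kn DV Vx Vy).
Qed.

Let iter_ge0 k z : 0 <= iter k (avg h) f z.
Proof.
elim: k z => [z|k IH z]; first exact: powR_ge0.
by rewrite iterS /avg divr_ge0// addr_ge0 ?IH.
Qed.

Let Phi_meas k : (k <= n)%N -> measurable_fun setT (EFin \o Phi k).
Proof.
move=> kn; apply/measurable_EFinP.
exact: (block_const_measurable Dfilt (Phi_const kn)).
Qed.

(** On a block of [D k] everything but the increment is constant, and [iter_avg_step] bounds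
    [Phi k.+1] by the constant value of [Phi k] plus a multiple of [d k], whose integral over the
    block is zero. *)
Let Phi_step k : (k < n)%N ->
  (\int[mu]_x (Phi k.+1 x)%:E <= \int[mu]_x (Phi k x)%:E)%E.
Proof.
move=> kn; apply: (ge0_integral_le_blocks Dfilt (k := k)).
- exact: Phi_meas.
- exact/Phi_meas/ltnW.
- by move=> x; rewrite lee_fin; exact: iter_ge0.
- by move=> x; rewrite lee_fin; exact: iter_ge0.
move=> V DV; have [_ _ /(_ _ DV) [x0 Vx0]] := dfilt_partition Dfilt k.
have mV := dfilt_measurable Dfilt DV.
have b0 : 0 <= b k x0 by rewrite (le_trans _ (d_le_b x0 kn)).
have h2 : 0 < h ^+ 2 by rewrite exprn_gt0.
have bn : b k x0 ^+ 2 <= (nsteps k x0)%:R * h ^+ 2.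
  by rewrite -ler_pdivrMr// ltW// truncnS_gt.
have [C HC] := @iter_avg_step _ f h (K - N k.+1 x0) (nsteps k x0) (M k x0) _ cf sf b0 bn.
(* The truncated subtractions are exact because [N k.+1 x0 <= K]. *)
have NK : (K - N k.+1 x0 + nsteps k x0)%N = (K - N k x0)%N.
  have := N_mono x0 kn; rewrite /N big_ord_recr/=; lia.
rewrite NK -/(Phi k x0) in HC.
have Phi1 x : V x -> Phi k.+1 x <= Phi k x0 + C * d k x.
  move=> Vx; rewrite /Phi /M big_ord_recr/= -/(M k x).
  rewrite (M_const (ltnW kn) DV Vx Vx0).
  have -> : N k.+1 x = N k.+1 x0.
    rewrite /N !big_ord_recr/= -/(N k x) -/(N k x0) (N_const (ltnW kn) DV Vx Vx0).
    by rewrite /nsteps (b_const kn DV Vx Vx0).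
  apply: HC; rewrite (le_trans (d_le_b x kn))//.
  by rewrite (b_const kn DV Vx Vx0).
have dV : mu.-integrable V (EFin \o d k).
  by apply: integrableS (d_int kn).
have cV : mu.-integrable V (fun=> (Phi k x0)%:E).
  by apply: (integrableS measurableT) => //; exact: finite_measure_integrable_cst.
have CdV : mu.-integrable V (fun x => (C%:E * (EFin \o d k) x)%E).
  exact: integrableZl.
apply: (@le_trans _ _ (\int[mu]_(x in V) ((Phi k x0)%:E + C%:E * (EFin \o d k) x))%E).
  apply: ge0_le_integral => //.
  - by move=> x _; rewrite lee_fin; exact: iter_ge0.
  - by apply: measurable_funTS; exact: Phi_meas.
  - apply: emeasurable_funD; first by have /integrableP[] := cV.
    by have /integrableP[] := CdV.
rewrite integralD// integralZl// d_mean0// mule0 adde0.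
rewrite le_eqVlt; apply/orP; left; apply/eqP.
apply: eq_integral => x /set_mem Vx.
by rewrite (Phi_const (ltnW kn) DV Vx Vx0).
Qed.

Lemma martingale_walk_bound :
  (\int[mu]_x (`|\sum_(i < n) d i x| `^ p)%:E <= (h `^ p * walk_moment p K)%:E)%E.
Proof.
have Phi_le k : (k <= n)%N -> (\int[mu]_x (Phi k x)%:E <= \int[mu]_x (Phi 0 x)%:E)%E.
  elim: k => // k IH kn; apply: (le_trans (Phi_step kn)); exact/IH/ltnW.
apply: (@le_trans _ _ (\int[mu]_x (Phi n x)%:E)%E).
  apply: ge0_le_integral => //.
  - apply/measurable_EFinP.
    apply: (block_const_measurable Dfilt (k := n)) => V x y DV Vx Vy.
    by rewrite -/(M n x) -/(M n y) (M_const (leqnn n) DV Vx Vy).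
  - exact: Phi_meas.
  (* The unspent symmetric steps can only increase the convex function [f]. *)
  - move=> x _; rewrite lee_fin /Phi; elim: (K - N n x)%N => [|k IH]; first exact: lexx.
    by rewrite (le_trans IH)// iterS; apply: le_avg_self; exact: cvx_iter_avg.
apply: (le_trans (Phi_le _ (leqnn n))).
have -> : (\int[mu]_x (Phi 0 x)%:E = \int[mu]_x (cst (h `^ p * walk_moment p K)%:E) x)%E.
  apply: eq_integral => x _; rewrite /Phi /M /N !big_ord0 subn0 walk_moment_scale.
  by rewrite gtr0_norm.
by rewrite integral_cst//= probability_setT mule1.
Qed.

End steps.

Lemma martingale_moment_bound (rho : R) : 0 < rho ->
  (forall x, \sum_(i < n) b i x ^+ 2 <= rho) ->
  (\int[mu]_x (`|\sum_(i < n) d i x| `^ p)%:E <= (rho `^ (p / 2) * gauss_moment p)%:E)%E.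
Proof.
move=> rho0 b_rho.
have p1 : 1 < p by rewrite (lt_le_trans _ p3)// ltr1n.
pose u m : R := rho `^ (p / 2) * (m.*2%:R / (m.*2%:R - n%:R)) `^ (p / 2) *
  (walk_moment p m.*2 / m.*2%:R `^ (p / 2)).
have cvu : u m.+1 @[m --> \oo] --> rho `^ (p / 2) * gauss_moment p.
  rewrite -(mulr1 (rho `^ (p / 2))).
  apply: cvgM; last exact: cvg_walk_moment.
  apply: cvgM; first exact: cvg_cst.
  rewrite -[X in _ --> X](_ : 1 `^ (p / 2) = 1 :> R); last by rewrite powR1.
  apply: (@continuous_cvg _ _ _ _ _ (fun m => m.+1.*2%:R / (m.+1.*2%:R - n%:R) : R)
    (fun x : R => x `^ (p / 2)) (1 : R)).
    have [hd _] := is_derive1_powR (p / 2) (@ltr01 R).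
    exact/differentiable_continuous/derivable1_diffP.
  have -> : (fun m => m.+1.*2%:R / (m.+1.*2%:R - n%:R)) =
      (fun m => (1 - n%:R / 2 * m.+1%:R^-1)^-1) :> (nat -> R).
    apply/funext => m.
    have m0 : m.+1%:R != 0 :> R by rewrite pnatr_eq0.
    rewrite -mul2n natrM.
    have -> : 2 * m.+1%:R - n%:R = 2 * m.+1%:R * (1 - n%:R / 2 * m.+1%:R^-1) :> R.
      by move: m.+1%:R m0 => z z0; field.
    by rewrite invfM mulVKf// mulf_neq0.
  rewrite -[X in _ --> X]invr1; apply: cvgV; first by rewrite oner_eq0.
  rewrite -[X in _ --> X]subr0; apply: cvgB; first exact: cvg_cst.
  rewrite -[X in _ --> X](mulr0 (n%:R / 2)); apply: cvgM; first exact: cvg_cst.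
  exact: cvg_harmonic.
have cvuE : (u m.+1)%:E @[m --> \oo] --> (rho `^ (p / 2) * gauss_moment p)%:E.
  apply: cvg_EFin => //; exact: nearW.
apply: (cvge_ge _ cvuE); near=> m.
have nm : (n < m.+1)%N by near: m; exists n.
have dm : 0 < m.+1.*2%:R - n%:R :> R.
  by rewrite subr_gt0 ltr_nat; lia.
(* Rounding costs at most one extra step per increment, so at most [rho / h ^+ 2 + n] steps are
   used; this choice of [h] makes that number equal to [m.+1.*2]. *)
pose h := Num.sqrt (rho / (m.+1.*2%:R - n%:R)).
have h0 : 0 < h by rewrite sqrtr_gt0 divr_gt0.
have h2 : h ^+ 2 = rho / (m.+1.*2%:R - n%:R) by rewrite sqr_sqrtr// ltW// divr_gt0.
apply: (le_trans (@martingale_walk_bound h m.+1.*2 h0 _)).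
  move=> x; rewrite -(ler_nat R) natr_sum.
  have h20 : 0 < h ^+ 2 by rewrite exprn_gt0.
  apply: (@le_trans _ _ (\sum_(i < n) (b i x ^+ 2 / h ^+ 2 + 1))).
    by apply: ler_sum => i _; rewrite -natr1 lerD2r truncn_le divr_ge0 ?sqr_ge0 ?ltW.
  rewrite big_split/= -mulr_suml sumr_const card_ord -lerBrDr.
  rewrite ler_pdivrMr// h2 mulrC divfK ?gt_eqF//.
rewrite lee_fin /u le_eqVlt; apply/orP; left; apply/eqP.
have -> : h `^ p = (h ^+ 2) `^ (p / 2).
  by rewrite -powR_mulrn ?ltW// -powRrM; congr (_ `^ _); field.
have m20 : 0 < m.+1.*2%:R :> R by rewrite ltr0n.
rewrite h2 !powRM ?invr_ge0 ?(ltW rho0) ?(ltW dm) ?(ltW m20)//.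
have : m.+1.*2%:R `^ (p / 2) != 0 :> R by rewrite gt_eqF// powR_gt0.
move: (m.+1.*2%:R `^ (p / 2)) => z z0.
by move: (walk_moment _ _) (_^-1 `^ _) => v w; field.
Unshelve. all: by end_near. Qed.

End MartingaleBound.

(** * From essential suprema to pointwise bounds *)

Section SquareFunction.
Context disp (T : measurableType disp) (R : realType) (mu : probability T R).
Variable D : nat -> set (set T).
Hypothesis Dfilt : discrete_filtration mu D.
Variables (n : nat) (d : 'I_n -> T -> R).
Hypothesis dmart : mdiff_sequence mu D d.
Implicit Types (i : 'I_n) (x y : T) (V W : set T).
Local Open Scope ereal_scope.

Lemma LnormyE (g : T -> \bar R) : 'N[mu]_+oo[g] = ess_sup mu (abse \o g).
Proof. by rewrite unlock /= probability_setT lte01. Qed.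

(** Blocks have positive measure, so a block on which [P] fails cannot lie in a null set. *)
Lemma ae_block k (P : T -> Prop) : block_const D k P ->
  (\forall x \ae mu, P x) -> forall x, P x.
Proof.
move=> cP [N [mN N0 PN]] x; have [W DW Wx] := block_of Dfilt k x.
apply: contrapT => nPx.
have WN : W `<=` N.
  by move=> y Wy; apply: PN => /=; rewrite -(cP W x y DW Wx Wy).
have := dfilt_gt0 Dfilt DW.
by rewrite (subset_measure0 (dfilt_measurable Dfilt DW) mN WN N0) ltxx.
Qed.

Lemma sup_blockE i V x : D i V -> V x ->
  sup_block mu D d i x = 'N[mu]_+oo[EFin \o (\1_V \* d i)%R].
Proof.
move=> DV Vx; rewrite /sup_block.
have t0 W : D i W -> 0 <= 'N[mu]_+oo[EFin \o (\1_W \* d i)%R] * (\1_W x)%:E.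
  by move=> _; rewrite mule_ge0 ?Lnorm_ge0// lee_fin indicE.
rewrite (esumID [set V])//.
rewrite (setIidr (_ : [set V] `<=` D i)); last by move=> W ->.
rewrite esum_set1; last exact: t0.
rewrite esum1 ?adde0; last first.
  move=> W [DW /= WV]; rewrite indicE memNset ?mule0// => Wx.
  by apply: WV; exact: (block_eq Dfilt DW DV Wx Vx).
by rewrite indicE mem_set// mule1.
Qed.

Lemma sup_block_ge0 i x : 0 <= sup_block mu D d i x.
Proof.
have [V DV Vx] := block_of Dfilt i x.
by rewrite (sup_blockE DV Vx) Lnorm_ge0.
Qed.

Lemma sup_block_const i : block_const D i (sup_block mu D d i).
Proof. by move=> V x y DV Vx Vy; rewrite !(sup_blockE DV). Qed.

(** The essential bound holds at every point by [ae_block], applied at level [i.+1]: there [d i] is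
    constant on blocks, and each block lies inside a single block of [D i]. *)
Lemma le_sup_block i x : `|d i x|%:E <= sup_block mu D d i x.
Proof.
have [V DV Vx] := block_of Dfilt i x.
rewrite (sup_blockE DV Vx) LnormyE; set N := ess_sup _ _.
have dc := adapted_block_const Dfilt (mdiff_adapted dmart (i := i)).
pose P y := V y -> `|d i y|%:E <= N.
suff : forall y, P y by apply.
apply: (@ae_block i.+1).
  move=> W y z DW Wy Wz; rewrite /P (dc W y z)//; apply/propext.
  have [V' DV' WV'] := block_sub Dfilt DW.
  have E u : W u -> V u -> V = V'.
    by move=> Wu Vu; apply: (block_eq Dfilt DV DV' Vu); exact: WV'.
  split => h Vz; apply: h; first by rewrite (E _ Wz Vz); exact: WV'.
  by rewrite (E _ Wy Vz); exact: WV'.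
have := ess_sup_ge mu (abse \o (EFin \o (\1_V \* d i)%R)).
apply: filterS => y /= h Vy; move: h.
by rewrite indicE mem_set// mul1r.
Qed.

Lemma square_function_const : block_const D n (square_function mu D d).
Proof.
move=> V x y DV Vx Vy; rewrite /square_function; congr (_ `^ _).
apply: eq_bigr => i _.
have c := @block_const_le _ _ _ _ _ Dfilt _ _ _ _ (ltnW (ltn_ord i)) (@sup_block_const i).
by rewrite (c V x y).
Qed.

(** The square function is constant on the blocks of [D n], so its essential bound [s] holds
    everywhere; a finite sum of squares then forces each term to be finite. *)
Lemma square_function_le (s : R) : 'N[mu]_+oo[square_function mu D d] = s%:E ->
  (forall i x, sup_block mu D d i x \is a fin_num) /\
  (forall x, (\sum_(i < n) fine (sup_block mu D d i x) ^+ 2 <= s ^+ 2)%R).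
Proof.
move=> sE.
have s0 : (0 <= s)%R by rewrite -lee_fin -sE Lnorm_ge0.
have Q x : \sum_(i < n) `|sup_block mu D d i x| ^+ 2 <= (s ^+ 2)%:E.
  have : square_function mu D d x <= s%:E.
    pose P y := square_function mu D d y <= s%:E.
    apply: (@ae_block n P).
      by move=> V y z DV Vy Vz; rewrite /P (square_function_const DV Vy Vz).
    have := ess_sup_ge mu (abse \o square_function mu D d).
    rewrite -LnormyE sE; apply: filterS => y /=; apply: le_trans.
    exact: lee_abs.
  rewrite /square_function.
  have : 0 <= \sum_(i < n) `|sup_block mu D d i x| ^+ 2.
    by apply: sume_ge0 => i _; rewrite expe_ge0.
  case: (\sum_(i < n) _) => [r| |]//.
    rewrite poweR_EFin !lee_fin => r0; rewrite powR12_sqrt// => rs.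
    by rewrite -[leLHS]sqr_sqrtr// ler_pXn2r ?nnegrE ?sqrtr_ge0.
  by rewrite poweRyr// gt_eqF// invr_gt0.
have Qi i x : `|sup_block mu D d i x| ^+ 2 <= (s ^+ 2)%:E.
  apply: le_trans (Q x); rewrite (bigD1 i)// leeDl//.
  by apply: sume_ge0 => j _; rewrite expe_ge0.
have fin i x : sup_block mu D d i x \is a fin_num.
  have := Qi i x; have := sup_block_ge0 i x.
  by case: (sup_block mu D d i x).
split => // x; rewrite -lee_fin; apply: le_trans (Q x).
rewrite -sumEFin; apply: lee_sum => i _.
by rewrite gee0_abs ?sup_block_ge0// EFin_expe fineK.
Qed.

End SquareFunction.

(** * The inequality with the Gaussian constant *)

Section UpperBound.
Context {R : realType}.
Implicit Type p : R.

Lemma walk_moment_ge p k : 3 <= p -> k%:R `^ (p / 2) <= walk_moment p k.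
Proof.
move=> p3; have p1 : 1 <= p by rewrite (le_trans _ p3)// ler1n.
rewrite /walk_moment.
have := @avg_le_iter R _ 1 k 0 (Num.sqrt k%:R) (cvx_norm_powR p1) (sqcvx_norm_powR p3).
rewrite sqr_sqrtr// expr1n mulr1 lexx => /(_ isT); apply: le_trans.
rewrite /avg add0r sub0r normrN ger0_norm ?sqrtr_ge0//.
rewrite -powR12_sqrt// -powRrM (_ : 2^-1 * p = p / 2); last by rewrite mulrC.
by move: (_ `^ (p / 2)) => a; lra.
Qed.

(** This supplies the positivity used when roots are taken, without a separate study of [Gamma]. *)
Lemma gauss_moment_ge1 p : 3 <= p -> 1 <= gauss_moment p.
Proof.
move=> p3; have p1 : 1 < p by rewrite (lt_le_trans _ p3)// ltr1n.
apply: (cvgr_to_ge (cvg_walk_moment p1)); apply: nearW => n /=.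
by rewrite ler_pdivlMr ?powR_gt0 ?ltr0n// mul1r walk_moment_ge.
Qed.

Lemma gauss_moment_root p : 3 <= p ->
  2 `^ (2^-1) * (Gamma ((p + 1) / 2) / Num.sqrt pi) `^ (p^-1) =
  gauss_moment p `^ p^-1.
Proof.
move=> p3; have p0 : 0 < p by rewrite (lt_le_trans _ p3).
have spi : 0 < Num.sqrt pi :> R by rewrite sqrtr_gt0 pi_gt0.
have E : gauss_moment p = 2 `^ (p / 2) * (Gamma ((p + 1) / 2) / Num.sqrt pi).
  by rewrite /gauss_moment mulrAC mulrA.
have G0 : 0 <= Gamma ((p + 1) / 2) / Num.sqrt pi.
  have := gauss_moment_ge1 p3; rewrite E => h.
  by rewrite -(@pmulr_rge0 _ (2 `^ (p / 2))) ?powR_gt0// (le_trans _ h).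
rewrite E [RHS]powRM ?powR_ge0// -powRrM; congr (_ `^ _ * _).
by rewrite mulrAC divff ?mul1r// gt_eqF.
Qed.

Lemma square_function_bound_gauss p : 3 <= p ->
  square_function_bound p (gauss_moment p `^ p^-1).
Proof.
move=> p3 disp T mu D n d n0 Dfilt dmart.
have p0 : 0 < p by rewrite (lt_le_trans _ p3).
have G1 := gauss_moment_ge1 p3; have G0 : 0 < gauss_moment p by rewrite (lt_le_trans _ G1).
have c0 : 0 < gauss_moment p `^ p^-1 by rewrite powR_gt0.
have [sE|[s sE]] : ('N[mu]_+oo[square_function mu D d] = +oo)%E \/
    exists s : R, ('N[mu]_+oo[square_function mu D d] = s%:E)%E.
  have := Lnorm_ge0 mu +oo%E (square_function mu D d).
  by case: ('N[mu]_+oo[_])%E => [s| |]//; [right; exists s|left].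
  by rewrite sE gt0_muley ?lte_fin// leey.
have s0 : 0 <= s by rewrite -lee_fin -sE Lnorm_ge0.
have [fin Q] := square_function_le Dfilt sE.
rewrite sE -EFinM.
have d_le i x : `|d i x| <= fine (sup_block mu D d i x).
  by rewrite -lee_fin fineK//; exact: le_sup_block.
(* [martingale_moment_bound] asks for a positive [rho]; when [s = 0] all the increments vanish
   identically. *)
move: s0; rewrite le_eqVlt => /predU1P[s00|s0].
  rewrite -s00 mulr0 (_ : EFin \o _ = cst 0%E); last first.
    apply/funext => x /=; rewrite big1// => i _; apply/eqP.
    rewrite -normr_le0 (le_trans (d_le i x))//.
    have := Q x; rewrite -s00 expr0n (bigD1 i)//= => h.
    have : fine (sup_block mu D d i x) ^+ 2 <= 0.
      apply: le_trans h; rewrite lerDl; apply: sumr_ge0 => j _; exact: sqr_ge0.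
    by rewrite real_exprn_even_le0 ?num_real//= => /eqP ->.
  by rewrite Lnorm0// gt_eqF// lte_fin.
(* Families indexed by ['I_n] are extended by 0 to all integers, the form used in the martingale
   bound. *)
pose ext (F : 'I_n -> T -> R) (k : nat) x : R := oapp (fun i => F i x) 0 (insub k).
have extE F (i : 'I_n) x : ext F i x = F i x by rewrite /ext valK.
have extE' F (k : nat) (kn : (k < n)%N) : ext F k = F (Ordinal kn).
  by apply/funext => x; rewrite -extE.
have bound : (\int[mu]_x (`|\sum_(i < n) ext d i x| `^ p)%:E <=
    ((s ^+ 2) `^ (p / 2) * gauss_moment p)%:E)%E.
  apply: (@martingale_moment_bound _ _ _ mu D Dfilt n (ext d)
    (ext (fun i x => fine (sup_block mu D d i x)))) => //.
  - by move=> i i_n; rewrite extE'; exact: (mdiff_integrable dmart).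
  - move=> i i_n; rewrite extE'.
    exact: (adapted_block_const Dfilt (mdiff_adapted dmart (i := Ordinal i_n))).
  - by move=> i V i_n DV; rewrite extE'; exact: (mdiff_mean0 dmart (i := Ordinal i_n)).
  - move=> i i_n; rewrite extE' => V x y DV Vx Vy.
    by rewrite (sup_block_const Dfilt d (i := Ordinal i_n) DV Vx Vy).
  - by move=> i x i_n; rewrite !extE'.
  - by rewrite exprn_gt0.
  - by move=> x; under eq_bigr do rewrite extE; exact: Q.
have sG0 : 0 <= (s ^+ 2) `^ (p / 2) * gauss_moment p by rewrite mulr_ge0 ?powR_ge0 ?ltW.
rewrite unlock /=.
have -> : (\int[mu]_x `|(\sum_(i < n) d i x)%:E| `^ p =
    \int[mu]_x (`|\sum_(i < n) ext d i x| `^ p)%:E)%E.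
  apply: eq_integral => x _; rewrite poweR_EFin; congr ((`|_| `^ p)%:E).
  by apply: eq_bigr => i _; rewrite extE.
have -> : gauss_moment p `^ p^-1 * s =
    ((s ^+ 2) `^ (p / 2) * gauss_moment p) `^ p^-1.
  rewrite powRM ?powR_ge0 ?(ltW G0)// mulrC; congr (_ * _).
  rewrite -powR_mulrn ?(ltW s0)// -!powRrM.
  rewrite (_ : 2 * (p / 2 / p) = 1) ?powRr1 ?(ltW s0)//.
  by field; rewrite gt_eqF.
rewrite -poweR_EFin; apply: gt0_ler_poweR => //.
- by rewrite invr_ge0 ltW.
- by rewrite in_itv/= leey andbT integral_ge0// => x _; rewrite lee_fin powR_ge0.
- by rewrite in_itv/= leey andbT lee_fin.
Qed.

End UpperBound.

(** * Optimality *)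

(** A sequence of [n] signs is encoded by the set of its positive positions. The alias carries the
    discrete sigma-algebra. *)
Definition cube n := {set 'I_n}.

HB.instance Definition _ n := Finite.on (cube n).
HB.instance Definition _ n := isPointed.Build (cube n) (finset.set0 : {set 'I_n}).
HB.instance Definition _ n := @isMeasurable.Build default_measure_display
  (cube n) discrete_measurable discrete_measurable0
  discrete_measurableC discrete_measurableU.

(** * The uniform probability on sign sequences *)

Section UniformMeasure.
Context {R : realType}.
Variable n : nat.
Implicit Types (V : set (cube n)) (A B : cube n) (F : cube n -> R).

Let cube_weight_ge0 : 0 <= (2 ^+ n)^-1 :> R.
Proof. by rewrite invr_ge0 exprn_ge0. Qed.

Definition cube_point (k : nat) : cube n := nth finset.set0 (enum (cube n)) k.

Definition cube_measure : set (cube n) -> \bar R :=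
  mscale (NngNum cube_weight_ge0)
    (msum (fun k => dirac (cube_point k)) (size (enum (cube n)))).

HB.instance Definition _ := Measure.on cube_measure.

Lemma sum_cube_point (G : cube n -> \bar R) :
  (\sum_(k < size (enum (cube n))) G (cube_point k) = \sum_A G A)%E.
Proof.
rewrite /cube_point -(big_mkord xpredT (fun k => G (nth finset.set0 (enum (cube n)) k))).
by rewrite -(big_nth finset.set0 xpredT) big_enum.
Qed.

Lemma ge0_integral_cube V F : (forall A, 0 <= F A) ->
  (\int[cube_measure]_(A in V) (F A)%:E =
   ((\sum_A F A * \1_V A) / 2 ^+ n)%:E)%E.
Proof.
move=> F0; have mV : measurable V by [].
rewrite ge0_integral_mscale//; last by move=> A _; rewrite lee_fin.
rewrite ge0_integral_measure_sum//; last by move=> A _; rewrite lee_fin.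
under eq_bigr do rewrite integral_dirac//.
rewrite (sum_cube_point (fun A => dirac A V * (F A)%:E)%E).
rewrite mulrC EFinM; congr (_ * _)%E.
rewrite -sumEFin; apply: eq_bigr => A _.
by rewrite diracE EFinM muleC indicE.
Qed.

Lemma cube_measure_setT : cube_measure setT = 1%E.
Proof.
rewrite -[LHS]mul1e -integral_cst//.
rewrite (@ge0_integral_cube _ (fun=> 1))//.
under eq_bigr do rewrite indicT mulr1.
have cE : #|cube n| = (2 ^ n)%N.
  by rewrite -cardsT -powersetT card_powerset cardsT card_ord.
by rewrite sumr_const cE natrX divff// expf_neq0.
Qed.

HB.instance Definition _ :=
  Measure_isProbability.Build _ _ _ cube_measure cube_measure_setT.

Lemma integrable_cube F V : cube_measure.-integrable V (EFin \o F).
Proof.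
apply/integrableP; split=> //.
under eq_integral do rewrite /=.
by rewrite (ge0_integral_cube V (fun A => normr_ge0 (F A))) ltry.
Qed.

(** The nonnegative case extends by writing [F] as the difference of [F + |F|] and [|F|]. *)
Lemma integral_cube V F :
  (\int[cube_measure]_(A in V) (F A)%:E =
   ((\sum_A F A * \1_V A) / 2 ^+ n)%:E)%E.
Proof.
have mV : measurable V by [].
have E : (fun A => (F A)%:E) =
    ((EFin \o (fun A => F A + `|F A|)%R) \- (EFin \o (fun A => `|F A|)%R))%E.
  by apply/funext => A /=; rewrite -EFinB addrK.
rewrite E integralB//; [|exact: integrable_cube..].
rewrite !ge0_integral_cube// => [|A]; last first.
  by have := ler_norm (- F A); rewrite normrN; lra.
rewrite -EFinB -mulrBl -sumrB; congr (_ / _)%:E.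
by apply: eq_bigr => A _; rewrite -mulrBl addrK.
Qed.

Lemma cube_measureE V : cube_measure V = ((\sum_A \1_V A) / 2 ^+ n)%:E :> \bar R.
Proof.
have mV : measurable V by [].
rewrite -[LHS]mul1e -integral_cst// (@integral_cube _ (fun=> 1)).
by under eq_bigr do rewrite mul1r.
Qed.

End UniformMeasure.

(** * The simple random walk as a discrete martingale *)

Section CubeFiltration.
Context {R : realType}.
Variable n : nat.
Implicit Types (V W : set (cube n)) (A B : cube n) (i j : 'I_n) (k : nat).

Local Notation mu := (@cube_measure R n).

Definition cylinder k A : set (cube n) :=
  [set B : cube n | forall j, (j < k)%N -> (j \in B) = (j \in A)].

Definition cube_filtration k : set (set (cube n)) := range (cylinder k).

Lemma cylinder_eq k A B : cylinder k A B -> cylinder k A = cylinder k B.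
Proof.
by move=> AB; apply/seteqP; split=> C /= h j jk; rewrite h// AB.
Qed.

Lemma cube_discrete_filtration : discrete_filtration mu cube_filtration.
Proof.
split.
- apply/seteqP; split => V /=.
    by move=> [A _ <-]; apply/seteqP; split=> // B _ j; rewrite ltn0.
  move=> ->; exists (finset.set0 : cube n) => //.
  by apply/seteqP; split=> // B _ j; rewrite ltn0.
- move=> k; apply: finite_set_countable; apply: finite_image.
  exact: finite_finset.
- move=> k; split.
  + by rewrite -subTset => A _; exists (cylinder k A) => //; exists A.
  + move=> _ _ [A _ <-] [B _ <-] [C [/cylinder_eq -> /cylinder_eq ->]] //.
  + by move=> _ [A _ <-]; exists A.
- by [].
- move=> k _ [A _ <-]; rewrite [ltRHS]cube_measureE lte_fin divr_gt0 ?exprn_gt0//.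
  by rewrite (bigD1 A)//= indicE mem_set// ltr_pwDl// sumr_ge0.
- move=> k _ [A _ <-]; exists [set cylinder k.+1 B | B in cylinder k A].
    by move=> _ [B _ <-]; exists B.
  apply/seteqP; split => B /=.
    by move=> AB; exists (cylinder k.+1 B) => //; exists B.
  move=> [_ [C AC <-] CB] j jk.
  by rewrite (CB j (ltnW jk)) AC.
Qed.

Definition walk_step i A : R := if i \in A then 1 else -1.

Definition flip i A : cube n := [set j | (j \in A) (+) (j == i)]%SET.

Lemma flipK i : involutive (flip i).
Proof. by move=> A; apply/setP => j; rewrite !inE -addbA addbb addbF. Qed.

Lemma walk_step_flip i A : walk_step i (flip i A) = - walk_step i A.
Proof. by rewrite /walk_step inE eqxx addbT; case: (i \in A); rewrite ?opprK. Qed.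

Lemma cylinder_flip i A B : cylinder i A (flip i B) <-> cylinder i A B.
Proof.
by split => h j ji; have := h j ji; rewrite inE (_ : (j == i) = false) ?addbF//;
  apply/negbTE; rewrite -val_eqE/= ltn_eqF.
Qed.

(** For the zero mean, flipping coordinate [i] is an involution that preserves the cylinders of
    level [i] and negates [walk_step i], so the sum equals its opposite. *)
Lemma walk_mdiff_sequence : mdiff_sequence mu cube_filtration walk_step.
Proof.
have Df := cube_discrete_filtration.
split => [i|i|i _ [A _ <-]].
- exact: integrable_cube.
- apply: (block_const_adapted Df) => _ B C [A _ <-] hB hC.
  by rewrite /walk_step hB// hC.
rewrite integral_cube; congr (_%:E); apply/eqP; rewrite mulf_eq0; apply/orP; left.
set S := (X in X == 0).
have : S = - S.
  rewrite {1}/S (reindex_inj (inv_inj (flipK i))) -sumrN; apply: eq_bigr => B _.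
  rewrite walk_step_flip mulNr !indicE; congr (- (_ * (nat_of_bool _)%:R)).
  by apply/idP/idP => /set_mem /cylinder_flip h; apply/mem_set.
by lra.
Qed.

Lemma sup_block_walk_le1 i A : (sup_block mu cube_filtration walk_step i A <= 1)%E.
Proof.
have [V DV VA] := block_of cube_discrete_filtration i A.
rewrite (sup_blockE cube_discrete_filtration walk_step DV VA) LnormyE.
apply/ess_supP; apply: nearW => B /=; rewrite lee_fin indicE /walk_step.
by case: (B \in V); case: (i \in B); rewrite ?mul1r ?mul0r ?normrN ?normr1 ?normr0.
Qed.

(** An upper bound suffices for optimality: for [0 <= c], replacing the norm by [Num.sqrt n%:R] only
    weakens the assumed inequality. *)
Lemma Lnorm_walk_square_function :
  ('N[mu]_+oo[square_function mu cube_filtration walk_step] <= (Num.sqrt n%:R)%:E)%E.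
Proof.
rewrite LnormyE; apply/ess_supP; apply: nearW => A /=.
have S0 : (0 <= \sum_(i < n) `|sup_block mu cube_filtration walk_step i A| ^+ 2)%E.
  by apply: sume_ge0 => i _; rewrite expe_ge0.
rewrite gee0_abs ?poweR_ge0// -powR12_sqrt// -poweR_EFin.
apply: gt0_ler_poweR; rewrite ?in_itv/= ?leey ?andbT ?lee_fin//.
apply: (@le_trans _ _ (\sum_(i < n) 1%E)%E).
  apply: lee_sum => i _.
  have := sup_block_ge0 cube_discrete_filtration walk_step i A.
  have := sup_block_walk_le1 i A.
  case: (sup_block _ _ _ _ _) => [r| |]//; rewrite !lee_fin => r1 r0.
  by rewrite ger0_norm// mulr_ile1.
by rewrite sumEFin sumr_const card_ord.
Qed.

Lemma sum_card_cube (F : nat -> R) :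
  \sum_(A : cube n) F #|A| = \sum_(i < n.+1) 'C(n, i)%:R * F i.
Proof.
rewrite (partition_big (fun A : cube n => inord #|A| : 'I_n.+1) xpredT)//=.
apply: eq_bigr => i _.
have An (A : cube n) : (#|A| < n.+1)%N.
  by rewrite ltnS (leq_trans (max_card _))// card_ord.
under eq_bigl => A do rewrite -val_eqE/= inordK//.
rewrite (eq_bigr (fun=> F i)); last by move=> A /eqP ->.
rewrite sumr_const mulr_natl; congr (_ *+ _).
have -> : 'C(n, i) = 'C(#|'I_n|, i) by rewrite card_ord.
rewrite -card_draws cardsE.
by apply: eq_card => A.
Qed.

Lemma sum_walk_step A : \sum_(i < n) walk_step i A = #|A|.*2%:R - n%:R.
Proof.
have -> : \sum_(i < n) walk_step i A = \sum_(i < n) ((i \in A)%:R * 2 - 1).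
  by apply: eq_bigr => i _; rewrite /walk_step; case: (i \in A) => /=; ring.
rewrite sumrB -mulr_suml -natr_sum sumr_const card_ord -natrM muln2.
congr (_.*2%:R - _); rewrite -sum1_card [RHS]big_mkcond.
by apply: eq_bigr => i _; case: (i \in A).
Qed.

Lemma integral_walk (p : R) : (\int[mu]_A (`|\sum_(i < n) walk_step i A| `^ p)%:E =
  (walk_moment p n)%:E)%E.
Proof.
rewrite (integral_cube _ (fun A => `|\sum_(i < n) walk_step i A| `^ p)).
congr (_%:E); rewrite /walk_moment iter_avgE; congr (_ / _).
rewrite -(sum_card_cube (fun k => `|0 + (k.*2%:R - n%:R)| `^ p)).
by apply: eq_bigr => A _; rewrite sum_walk_step add0r indicT mulr1.
Qed.

Lemma walk_moment_bound (p c : R) : 0 < p -> (0 < n)%N -> 0 < walk_moment p n ->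
  square_function_bound p c ->
  0 <= c /\ walk_moment p n / n%:R `^ (p / 2) <= c `^ p.
Proof.
move=> p0 n0 w0 /(_ _ _ mu _ _ _ n0 cube_discrete_filtration walk_mdiff_sequence).
have -> : ('N[mu]_p%:E[EFin \o (fun x => \sum_(i < n) walk_step i x)%R] =
    (walk_moment p n `^ p^-1)%:E)%E.
  by rewrite unlock /= -poweR_EFin -integral_walk; congr poweR.
have := Lnorm_walk_square_function.
have := Lnorm_ge0 mu +oo%E (square_function mu cube_filtration walk_step).
case: ('N[mu]_+oo[_])%E => [s| |]//.
rewrite -EFinM !lee_fin => s0 sn le_cs.
have cs : 0 < c * s by rewrite (lt_le_trans _ le_cs)// powR_gt0.
(* The left side of the inequality is positive and [s >= 0], so [c] cannot be negative. *)
have c0 : 0 <= c.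
  by rewrite leNgt; apply/negP => c0; move: cs; rewrite ltNge mulr_le0_ge0// ltW.
split => //.
have nR : 0 < n%:R :> R by rewrite ltr0n.
rewrite ler_pdivrMr ?powR_gt0//.
have -> : n%:R `^ (p / 2) = Num.sqrt n%:R `^ p.
  by rewrite -powR12_sqrt// -powRrM; congr (_ `^ _); field.
rewrite -powRM ?sqrtr_ge0//.
have -> : walk_moment p n = (walk_moment p n `^ p^-1) `^ p.
  by rewrite -powRrM mulVf ?gt_eqF// powRr1// ltW.
apply: ge0_ler_powR; rewrite ?nnegrE ?powR_ge0 ?mulr_ge0 ?sqrtr_ge0 ?(ltW p0)//.
by rewrite (le_trans le_cs)// ler_wpM2l.
Qed.

End CubeFiltration.

Lemma square_function_bound_ge (R : realType) (p c : R) : 3 <= p ->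
  square_function_bound p c -> gauss_moment p `^ p^-1 <= c.
Proof.
move=> p3 hc; have p1 : 1 < p by rewrite (lt_le_trans _ p3)// ltr1n.
have p0 : 0 < p by rewrite (lt_trans _ p1).
have h n : 0 <= c /\ walk_moment p n.+1.*2 / n.+1.*2%:R `^ (p / 2) <= c `^ p.
  apply: walk_moment_bound => //.
  by apply: lt_le_trans (walk_moment_ge _ p3); rewrite powR_gt0 ?ltr0n.
have c0 : 0 <= c by have [] := h 0%N.
have G : gauss_moment p <= c `^ p.
  apply: (cvgr_to_le (cvg_walk_moment p1)); apply: nearW => n.
  by have [] := h n.
have -> : c = (c `^ p) `^ p^-1 by rewrite -powRrM divff ?powRr1// gt_eqF.
apply: ge0_ler_powR; rewrite ?nnegrE ?powR_ge0 ?invr_ge0 ?(ltW p0)//.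
by rewrite (le_trans _ (gauss_moment_ge1 p3)).
Qed.

Theorem mainTheorem4 (R : realType) (p : R) (hp : 3 <= p) :
  square_function_bound p
    (2 `^ (2^-1) * (Gamma ((p + 1) / 2) / Num.sqrt pi) `^ (p^-1)) /\
  (forall c : R,
     c < 2 `^ (2^-1) * (Gamma ((p + 1) / 2) / Num.sqrt pi) `^ (p^-1) ->
     ~ square_function_bound p c).
Proof.
rewrite gauss_moment_root//; split; first exact: square_function_bound_gauss.
by move=> c + /(square_function_bound_ge hp); rewrite ltNge => /negP.
Qed.
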